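(* For every rooted graph $(R,G)$ with $e_R(G)>0$ and for every real $t>1$ there exist constants $c>0$ and $C>0$, depending only on $t$ and $(R,G)$, such that, with $p_1=t^{-1/e_R(G)}$ and $p_2=t^{-1/e(G)}$, for all integers $n\ge v(G)$ and all $p\in(0,1]$ the following hold, where $\mu=\mathbb E X_G^R$ and $M_{R,G}=M_{R,G}(n,p)$: (a) If $p\le n^{-1/m_R(G)}$, then $$p^{C}=\exp\{-C\log(1/p)\}\le \mathbb P(X_G^R\ge t\mu)\le\exp\{-c\}.$$ (b) If $n^{-1/m_R(G)}\le p\le p_1$, then $$p^{C M_{R,G}}=\exp\{-C M_{R,G}\log(1/p)\}\le \mathbb P(X_G^R\ge t\mu)\le\exp\{-c M_{R,G}\}.$$ (c) If $p_1\le p\le p_2$, then $$\exp\{-C(n+(p-p_1)^2n^2)\}\le \mathbb P(X_G^R\ge t\mu)\le\exp\{-c(n+(p-p_1)^2n^2)\}.$$ (d) If $p_2<p\le 1$, then $$\mathbb P(X_G^R\ge t\mu)=0.$$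
   Context: For a graph $H$, $v(H)$ and $e(H)$ denote its numbers of vertices and edges. A rooted graph $(R,G)$ is a finite simple graph $G$ with a fixed independent set $R\subseteq V(G)$ (the roots); let $r=|R|$. $G-R$ is the graph obtained from $G$ by deleting all vertices of $R$ together with incident edges; for a subgraph $H$ of $G$, $H-R$ is obtained from $H$ by deleting all vertices of $R$ that lie in $H$, with incident edges. $e_R(G)=e(G)-e(G-R)$ is the number of edges of $G$ incident with $R$. For a graph $F$ on vertex set $[n]=\{1,\dots,n\}$, regarded as rooted at $[r]=\{1,\dots,r\}$, an $R$-rooted copy of $G$ in $F$ is a (not necessarily induced) subgraph of $F$ which is isomorphic to $G$ by an isomorphism that maps $R$ onto $[r]$. $N^R(F,G)$ is the number of $R$-rooted copies of $G$ in $F$. $G(n,p)$ is the binomial random graph on $[n]$, in which each of the $\binom n2$ possible edges is present independently with probability $p$. $X_G^R=X_G^R(n,p)=N^R(G(n,p),G)$, and $\mu=\mathbb E X_G^R=N^R(K_n,G)p^{e(G)}$, where $K_n$ is the complete graph on $[n]$. For a subgraph $H$ of $G$, $\Psi_H^R=\Psi_H^R(n,p)=n^{v(H-R)}p^{e(H)}$. The fractional independence number $\alpha^*(H)$ of a graph $H$ is the maximum of $\sum_{i}x_i$ over all assignments $(x_i)_{i\in V(H)}$ with $0\le x_i\le 1$ for all $i\in V(H)$ and $x_i+x_j\le 1$ for every edge $ij\in H$. Define $$M_{R,G}=M_{R,G}(n,p)=\min_{H\subseteq G,\ e(H)>0}\left(\Psi_H^R\right)^{1/\alpha^*(H-R)},\qquad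 m_R(G)=\max_{H\subseteq G,\ e(H)>0}\frac{e(H)}{v(H-R)},$$ where the minimum and maximum are over all subgraphs $H$ of $G$ with at least one edge.
   Formalization: In (a), the lower bound p^C ≤ P(X ≥ tμ) is asserted only when also p ≤ p_2; for p > p_2 it contradicts (d), e.g. for G = K_2 with one root, t = 3, n = 2, p = 2/5, where the probability is 0. *)

(* Defs.v *)
From HB Require Import structures.
From mathcomp Require Import all_boot all_order all_algebra.
From mathcomp Require Import all_classical all_reals all_analysis.

Set Implicit Arguments.
Unset Strict Implicit.
Unset Printing Implicit Defensive.

Import Order.TTheory GRing.Theory Num.Theory.

Local Open Scope ring_scope.

(* Finite simple graphs whose vertices are taken in an ambient finite type, so
   that the subgraphs of a graph live in the same type. An edge is a 2-element
   set of vertices. *)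
Definition is_graph (T : finType) (H : {set T} * {set {set T}}) : bool :=
  [forall e in H.2, (e \subset H.1) && (#|e| == 2)%N].

Record graph (T : finType) :=
  Graph { graph_val : {set T} * {set {set T}}; _ : is_graph graph_val }.

HB.instance Definition _ (T : finType) := [isSub for @graph_val T].
HB.instance Definition _ (T : finType) := [Countable of graph T by <:].
HB.instance Definition _ (T : finType) := [Finite of graph T by <:].

Section Graphs.
Variable T : finType.
Implicit Types (G H : graph T) (W : {set T}).

Definition vertices G : {set T} := (graph_val G).1.
Definition edges G : {set {set T}} := (graph_val G).2.
Definition adj G : rel T := fun x y => [set x; y] \in edges G.

Definition nv G : nat := #|vertices G|.
Definition ne G : nat := #|edges G|.

Definition subgraph H G : bool :=
  (vertices H \subset vertices G) && (edges H \subset edges G).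

Lemma del_is_graph G W :
  is_graph (vertices G :\: W, [set e in edges G | [disjoint e & W]]).
Proof.
apply/forall_inP => e; rewrite inE => /andP[eG eW].
have /forall_inP/(_ e eG)/andP[eV ->] : is_graph (graph_val G) by case: G {eG}.
by rewrite andbT finset.subsetD eV.
Qed.

(* G - W; W need not be contained in the vertex set of G. *)
Definition del G W : graph T := Graph (del_is_graph G W).

Definition ne_root W G : nat := (ne G - ne (del G W))%N.

Definition rooted W G : Prop :=
  W \subset vertices G /\ {in W &, forall x y, ~~ adj G x y}.

End Graphs.

(* There is an isomorphism from G to K that maps W onto W'. Only the values of
   f on the vertices of G matter. *)
Definition rooted_iso (T U : finType) (W : {set T}) (G : graph T)
    (W' : {set U}) (K : graph U) : bool :=
  [exists f : {ffun T -> U},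
    [&& dinjectiveb f (vertices G),
        f @: vertices G == vertices K,
        [set f @: (e : {set T}) | e in edges G] == edges K
      & f @: W == W']].

(* The vertex set [n] is 'I_n, and the root set [r] is {0, ..., r - 1}. *)
Definition ncopies (T : finType) (W : {set T}) (G : graph T)
    (n : nat) (F : graph 'I_n) : nat :=
  #|[set K : graph 'I_n |
      subgraph K F & rooted_iso W G [set i : 'I_n | (i < #|W|)%N] K]|.

Section RandomGraph.
Variables (R : realType) (n : nat) (p : R).

(* The probability of the outcome F under G(n,p), where F has vertex set [n]. *)
Definition gnp_mass (F : graph 'I_n) : R :=
  p ^+ ne F * (1 - p) ^+ ('C(n, 2) - ne F).

Definition gnp_prob (A : pred (graph 'I_n)) : R :=
  \sum_(F : graph 'I_n | (vertices F == [set: 'I_n]) && A F) gnp_mass F.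

Definition gnp_mean (X : graph 'I_n -> R) : R :=
  \sum_(F : graph 'I_n | vertices F == [set: 'I_n]) gnp_mass F * X F.

End RandomGraph.

Section Tail.
Variables (R : realType) (T : finType).
Implicit Types (G H : graph T) (W : {set T}).

Definition mu W G (n : nat) (p : R) : R :=
  gnp_mean p (fun F : graph 'I_n => (ncopies W G F)%:R).

Definition upper_tail W G (n : nat) (p t : R) : R :=
  gnp_prob p (fun F : graph 'I_n => t * mu W G n p <= (ncopies W G F)%:R).

Definition frac_indep_assignment H (x : T -> R) : Prop :=
  (forall i, i \in vertices H -> 0 <= x i <= 1) /\
  (forall i j, adj H i j -> x i + x j <= 1).

Definition frac_indep H : R :=
  sup [set s | exists2 x : T -> R, frac_indep_assignment H x &
                 s = \sum_(i in vertices H) x i]%classic.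

Definition Psi W H (n : nat) (p : R) : R :=
  n%:R ^+ nv (del H W) * p ^+ ne H.

(* If G has an edge then G itself is one of the subgraphs in the range, so the
   initial value of the iterated minimum does not affect the result. *)
Definition M_param W G (n : nat) (p : R) : R :=
  let F H := Psi W H n p `^ (frac_indep (del H W))^-1 in
  \big[Num.min/F G]_(H : graph T | subgraph H G && (0 < ne H)%N) F H.

Definition m_param W G : R :=
  \big[Num.max/0]_(H : graph T | subgraph H G && (0 < ne H)%N)
    ((ne H)%:R / (nv (del H W))%:R).

End Tail.

(* Main.v *)
From HB Require Import structures.
Require Import Defs.
From mathcomp Require Import all_boot all_order all_algebra.
From mathcomp Require Import all_classical all_reals all_analysis.
From mathcomp Require Import zify ring lra.
From mathcomp Require Import fintype finset.

Set Implicit Arguments.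
Unset Strict Implicit.
Unset Printing Implicit Defensive.
Import Order.TTheory GRing.Theory Num.Theory.

(** Let X be the number of copies, N = O(n ^ (v - r)) their number in the
complete graph, and mu = N p ^ e the mean, where G has v vertices, r of them
roots, and e edges.

The upper bounds come from the moments of X. In the expansion of E(X ^ m) over
m-tuples of copies, let the copies be added one at a time. Given the at most
(m - 1) e edges F of the previous ones, the expected number of copies is at most
some B, so that E(X ^ m) <= B ^ m, and the tail at l is at most (B / l) ^ m
(moment_bound, ncontained_tail). A copy that meets F in the image of a subgraph
H saves the factor p ^ e(H). The number of ways to place H in F is of order at
most k ^ a, where F has k edges and a is the fractional independence number of
H - R (card_embs_in). For k = c M with c small this is at most a small multiple
of Psi_H, so that B is at most (1 + t) / 2 times mu (overlap_term_le), and
moments of order M give exp(- c M). If p >= p1, the same method is applied to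
the graph in which all edges at the roots are present: there the mean is still
below t mu, by a relative amount of at least p - p1, and F changes it by a
relative amount O(#|F| / n ^ 2), which allows moments of order (p - p1) n ^ 2
(upper_tail_le_exp_sq).

The bound k ^ a comes from a greedy count (ntraces_bound_split). Call a vertex of F big if its degree exceeds the square root of k; there are
O(sqrt k) of these. Among the placements of H with a given set of vertices sent
to big vertices, the free choices are counted along a matching provided by
Hall's theorem. The exponent so obtained is the weight of the assignment that is
1 on a set of independent vertices of largest deficiency, 0 on its neighbours
and 1/2 elsewhere, and hence is at most a.

The lower bounds come from a change of measure. If the edges are present with
individual probabilities q instead of p, then, by Cauchy-Schwarz, the original
probability of an event is at least the square of the new one, divided by the
product of the factors 1 + (q - p) ^ 2 / (p (1 - p)) (change_of_measure). As
X <= N, the new probability of X >= t mu is at least the excess of the new mean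
over t mu, divided by N (ncontained_ge_prob), so only the new mean has to be
computed. For small p one takes q = 1 on a blow-up with O(M) edges of a subgraph
H that attains the minimum M, where vertex i is replaced by about (K M) ^ x_i
vertices and x is a nearly optimal fractional independent assignment
(blowup_lower). If p is bounded away from 0, one takes q = 1 on all pairs at the
roots, and q = p + K (p - p1) + 1/n on the others (dense_lower). *)

(** * Hall's theorem *)

Section Hall.
Variable T : finType.
Implicit Types (e : rel T) (A B I : {set T}).

Definition nbrs e A B : {set T} := [set y in B | [exists x in A, e x y]].

Lemma nbrs_sub e A B : nbrs e A B \subset B.
Proof. by apply/subsetP => y; rewrite inE => /andP[]. Qed.

Lemma nbrsU e A A' B : nbrs e (A :|: A') B = nbrs e A B :|: nbrs e A' B.
Proof.
apply/setP => y; rewrite !inE -andb_orr; congr (_ && _); apply/existsP/orP.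
  by case=> x; rewrite inE => /andP[/orP[xA|xA] exy]; [left|right];
    apply/existsP; exists x; rewrite xA.
by case=> /existsP[x /andP[xA exy]]; exists x; rewrite inE xA ?orbT.
Qed.

Lemma nbrsD e A B C : nbrs e A (B :\: C) = nbrs e A B :\: C.
Proof. by apply/setP => y; rewrite !inE andbA. Qed.

(** By induction on I: a proper tight subset splits the problem into two smaller
ones, and without tight subsets any pair can be matched first. *)
Lemma hall e I B :
  (forall A, A \subset I -> #|A| <= #|nbrs e A B|) ->
  exists2 f : T -> T, {in I &, injective f} &
    forall x, x \in I -> f x \in B /\ e x (f x).
Proof.
have [m] := ubnP #|I|; elim: m => // m IHm in I B * => leIm hallI.
have [I0 | [x xI]] := set_0Vmem I.
  by exists id => x; rewrite I0 !inE.
have [[A [sAI A0 tight]] | loose] :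
    (exists A, [/\ A \proper I, A != set0 & #|A| = #|nbrs e A B|]) \/
    (forall A, A \proper I -> A != set0 -> #|A| < #|nbrs e A B|).
- case: (pickP (fun A : {set T} =>
      [&& A \proper I, A != set0 & #|A| == #|nbrs e A B|])).
    by move=> A /and3P[pA A0 /eqP tA]; left; exists A.
  move=> none; right => A pA A0; have := none A; rewrite pA A0 /= => neq.
  by rewrite ltn_neqAle neq hallI // proper_sub.
- have ltAI : #|A| < #|I| by apply: proper_card.
  have sAI' := proper_sub sAI.
  have [|A' sA' |f f_inj fP] := IHm A B.
  + exact: leq_trans ltAI _.
  + by apply: hallI; apply: subset_trans sAI'.
  have cardDA : #|I :\: A| = (#|I| - #|A|)%N.
    by rewrite cardsD (setIidPr sAI').
  have A_gt0 : 0 < #|A| by rewrite card_gt0.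
  have [|C sC|g g_inj gP] := IHm (I :\: A) (B :\: nbrs e A B).
  + rewrite cardDA; lia.
  + have dAC : [disjoint A & C].
      by rewrite disjoint_sym; move: sC; rewrite subsetD => /andP[].
    have /hallI : A :|: C \subset I.
      by rewrite subUset sAI' (subset_trans sC) // subsetDl.
    rewrite nbrsU nbrsD -(cardsID (nbrs e A B) (_ :|: nbrs _ _ _)) setIUl setIid.
    rewrite (setUidPl (subsetIr _ _)) setDUl setDv set0U.
    by rewrite cardsU disjoint_setI0 // cards0 subn0 tight leq_add2l.
  exists (fun z => if z \in A then f z else g z) => [z w zI wI | z zI].
    case: ifPn => zA; case: ifPn => wA.
    * exact: f_inj.
    * move=> fg; have [] := gP w; first by rewrite inE wA.
      rewrite -fg in_setD => /andP[/negP fzN _] _; case: fzN.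
      have [fB ezf] := fP z zA.
      by rewrite inE fB /=; apply/existsP; exists z; rewrite zA.
    * move=> fg; have [] := gP z; first by rewrite inE zA.
      rewrite fg in_setD => /andP[/negP fwN _] _; case: fwN.
      have [fB ezf] := fP w wA.
      by rewrite inE fB /=; apply/existsP; exists w; rewrite wA.
    * by apply: g_inj; rewrite inE ?zA ?wA.
  case: ifPn => zA; first exact: fP.
  have [|] := gP z; first by rewrite inE zA.
  by rewrite inE => /andP[].
have [b bN] : exists b, b \in nbrs e [set x] B.
  apply/set0Pn; rewrite -card_gt0; apply: leq_trans (hallI _ _).
    by rewrite cards1.
  by rewrite sub1set.
have [bB exb] : b \in B /\ e x b.
  by move: bN; rewrite inE => /andP[-> /existsP[y /andP[/set1P ->]]].
have [|A sA|f f_inj fP] := IHm (I :\ x) (B :\ b).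
- move: leIm; rewrite (cardsD1 x I) xI; lia.
- have [->|A0] := eqVneq A set0; first by rewrite cards0.
  have /loose/(_ A0) : A \proper I.
    by apply: sub_proper_trans sA _; rewrite properD1.
  rewrite nbrsD (cardsD1 b (nbrs e A B)); case: (b \in _) => /=; lia.
exists (fun z => if z == x then b else f z) => [z w zI wI | z zI].
  case: eqP => [->|/eqP zx]; case: eqP => [->|/eqP wx] //.
  - by move=> bf; have [] := fP w; rewrite !inE ?wx // -bf eqxx.
  - by move=> fb; have [] := fP z; rewrite !inE ?zx // fb eqxx.
  - by apply: f_inj; rewrite !inE ?zx ?wx.
case: eqP => [->|/eqP zx] //; have [|] := fP z; first by rewrite !inE zx.
by rewrite !inE => /andP[].
Qed.

End Hall.

(** * Families of maps into a graph with few edges *)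

Lemma card_le_fibers (A B : finType) (phi : A -> B) (X : {set A}) (Y : {set B}) c :
  (forall a, a \in X -> phi a \in Y) ->
  (forall b, b \in Y -> #|[set a in X | phi a == b]| <= c) ->
  #|X| <= #|Y| * c.
Proof.
move=> XY fib; rewrite -sum1_card (partition_big phi (mem Y)) //=.
rewrite -sum_nat_const; apply: leq_sum => b bY.
apply: leq_trans (fib b bY); rewrite -sum1_card leq_eqVlt; apply/orP; left.
by apply/eqP/eq_bigl => a; rewrite inE.
Qed.

Section Traces.
Variables T S : finType.
Implicit Types (P : {set {ffun T -> S}}) (D : {set T}) (F : {set {set S}}).

(** Restrictions take values in option S, so that two maps have the same
restriction to D exactly if they agree on D. *)
Definition restr D (f : {ffun T -> S}) : {ffun T -> option S} :=
  [ffun x => if x \in D then Some (f x) else None].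

Definition ntraces P D : nat := #|restr D @: P|.

Lemma ntracesT P : ntraces P setT = #|P|.
Proof.
apply: card_imset => f g /ffunP fg; apply/ffunP => x.
by have := fg x; rewrite !ffunE inE => -[].
Qed.

Lemma ntraces0 P : ntraces P set0 <= 1.
Proof.
rewrite -(cards1 ([ffun=> None] : {ffun T -> option S})).
apply/subset_leq_card/subsetP => _ /imsetP[f _ ->]; apply/set1P/ffunP => x.
by rewrite !ffunE inE.
Qed.

(** This subadditivity lets the choices for disjoint parts of the domain be
counted separately. *)
Lemma ntracesU P D D' : ntraces P (D :|: D') <= ntraces P D * ntraces P D'.
Proof.
pose glue (gg : {ffun T -> option S} * {ffun T -> option S}) :=
  [ffun x => if x \in D then gg.1 x else gg.2 x].
rewrite -cardsX; apply: leq_trans (leq_imset_card glue _).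
apply/subset_leq_card/subsetP => _ /imsetP[f fP ->]; apply/imsetP.
exists (restr D f, restr D' f); first by rewrite in_setX !imset_f.
apply/ffunP => x; rewrite !ffunE /= in_setU.
by case: (x \in D); rewrite // ffunE.
Qed.

Lemma ntraces1 P x : ntraces P [set x] <= #|[set f x | f : {ffun T -> S} in P]|.
Proof.
pose put (s : S) := [ffun y => if y \in [set x] then Some s else None].
apply: leq_trans (leq_imset_card put _); apply/subset_leq_card/subsetP.
move=> _ /imsetP[f fP ->]; apply/imsetP; exists (f x); first exact: imset_f.
by apply/ffunP => y; rewrite !ffunE inE; case: eqP => [->|].
Qed.

Lemma ntraces_pow P D c :
  (forall x, x \in D -> ntraces P [set x] <= c) -> ntraces P D <= c ^ #|D|.
Proof.
have [m] := ubnP #|D|; elim: m => // m IHm in D * => leDm Dc.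
have [-> | [x xD]] := set_0Vmem D; first by rewrite cards0 ntraces0.
rewrite -(setD1K xD); apply: leq_trans (ntracesU _ _ _) _.
rewrite cardsU1 !inE eqxx /= expnS leq_mul ?Dc // IHm //.
  by move: leDm; rewrite (cardsD1 x D) xD.
by move=> y /setD1P[_ /Dc].
Qed.

Definition degree F (v : S) : nat := #|[set w | [set v; w] \in F]|.

(** Every edge is the image of at most two ordered pairs. *)
Lemma card_orient F : #|[set vw : S * S | [set vw.1; vw.2] \in F]| <= #|F| * 2.
Proof.
apply: (card_le_fibers (phi := fun vw => [set vw.1; vw.2])) => [vw|f fF].
  by rewrite inE.
have [->|[[a b]]] := set_0Vmem [set vw in [set vw : S * S | [set vw.1; vw.2] \in F] |
                      [set vw.1; vw.2] == f]; first by rewrite cards0.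
rewrite !inE /= => /andP[_ /eqP abf].
apply: leq_trans (_ : #|[set (a, b); (b, a)]| <= _); last first.
  by rewrite cards2; case: (_ == _).
apply/subset_leq_card/subsetP => -[c d]; rewrite !inE /= => /andP[_ /eqP cdf].
have eq_abcd : [set c; d] = [set a; b] by rewrite cdf abf.
have := set21 c d; have := set22 c d; rewrite !eq_abcd !inE.
have := set21 a b; have := set22 a b; rewrite -!eq_abcd !inE.
rewrite !xpair_eqE !(eq_sym c) !(eq_sym d).
by do 4![case: (_ == _) => //=].
Qed.

Lemma sum_degree F : \sum_v degree F v <= #|F| * 2.
Proof.
apply: leq_trans (card_orient F).
rewrite (eq_bigr (fun v => \sum_(w | [set v; w] \in F) 1)); last first.
  by move=> v _; rewrite /degree -sum1_card; apply: eq_bigl => w; rewrite inE.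
rewrite pair_big_dep /= sum1_card leq_eqVlt; apply/orP; left; apply/eqP.
by apply: eq_card => -[v w]; rewrite !inE.
Qed.

(** As s + 1 exceeds sqrt #|F|, each of these vertices uses up more than sqrt #|F|
of the total degree, which is at most 2 #|F|. *)
Lemma card_big_degree F s : #|F| < s.+1 ^ 2 ->
  #|[set v | s < degree F v]| ^ 2 <= 4 * #|F|.
Proof.
move=> ltFs; set b := #|_|; set k := #|F| in ltFs *.
have : b * s.+1 <= k * 2.
  apply: leq_trans (sum_degree F).
  rewrite -sum_nat_const [leqLHS](_ : _ = \sum_(v | s < degree F v) s.+1)//; last first.
    by apply: eq_bigl => v; rewrite inE.
  rewrite big_mkcond /=; apply: leq_sum => v _; by case: ifP.
move: ltFs; rewrite !expnS !expn0 !muln1; move: b k => b k; nia.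
Qed.

Lemma ntraces_edge P F x y :
  (forall f, f \in P -> [set f x; f y] \in F) ->
  ntraces P [set x; y] <= #|F| * 2.
Proof.
move=> PF; apply: leq_trans (card_orient F).
pose put (vw : S * S) : {ffun T -> option S} :=
  [ffun z => if z == x then Some vw.1 else if z == y then Some vw.2 else None].
apply: leq_trans (leq_imset_card put _); apply/subset_leq_card/subsetP.
move=> _ /imsetP[f fP ->]; apply/imsetP; exists (f x, f y).
  by rewrite inE /= PF.
by apply/ffunP => z; rewrite !ffunE !inE /=; do 2![case: eqP => [->|_] //=].
Qed.

Lemma ntraces_touch P F x :
  (forall f, f \in P -> exists w, [set f x; w] \in F) ->
  ntraces P [set x] <= #|F| * 2.
Proof.
move=> PF; apply: leq_trans (ntraces1 _ _) _; apply: leq_trans (card_orient F).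
apply: leq_trans (leq_imset_card fst _); apply/subset_leq_card/subsetP.
move=> _ /imsetP[f fP ->]; have [w fxwF] := PF f fP.
by apply/imsetP; exists (f x, w) => //; rewrite inE.
Qed.

(** A neighbour y of a vertex x with an image of small degree costs only a factor
s, once the image of x is known. *)
Lemma ntraces_small P F D x y s :
  x \in D ->
  (forall f, f \in P -> [set f x; f y] \in F /\ degree F (f x) <= s) ->
  ntraces P (y |: D) <= ntraces P D * s.
Proof.
move=> xD PF.
pose cut (g : {ffun T -> option S}) : {ffun T -> option S} :=
  [ffun z => if z \in D then g z else None].
apply: (card_le_fibers (phi := cut)) => [_ /imsetP[f fP ->] | _ /imsetP[f fP ->]].
  apply/imsetP; exists f => //; apply/ffunP => z; rewrite !ffunE !inE.
  by case: ifP => // ->; rewrite orbT.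
have [_] := PF f fP; apply: leq_trans.
pose put (w : S) : {ffun T -> option S} :=
  [ffun z => if z \in D then Some (f z) else if z == y then Some w else None].
apply: leq_trans (leq_imset_card put _); apply/subset_leq_card/subsetP.
move=> _ /setIdP[/imsetP[g gP ->] /eqP/ffunP fg].
have fgD z : z \in D -> g z = f z.
  by move=> zD; have := fg z; rewrite !ffunE zD !inE zD orbT => -[].
apply/imsetP; exists (g y).
  by rewrite inE -(fgD x xD); have [] := PF g gP.
apply/ffunP => z; rewrite !ffunE in_setU1.
case: (boolP (z \in D)) => zD; first by rewrite orbT fgD.
by rewrite orbF; case: eqP => [->|].
Qed.

End Traces.

(** Here the set B of the vertices that are sent to vertices of large degree is
the same for all maps in P. *)
Section TraceBound.
Variables T S : finType.
Variables (P : {set {ffun T -> S}}) (F : {set {set S}}) (adj : rel T).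
Variables (U B : {set T}) (s : nat).
Hypothesis adj_sym : symmetric adj.
Hypothesis PF : forall f x y, f \in P -> x \in U -> y \in U -> adj x y ->
  [set f x; f y] \in F.
Hypothesis Ptouch : forall f x, f \in P -> x \in U -> exists w, [set f x; w] \in F.
Hypotheses (sBU : B \subset U) (s_lo : s ^ 2 <= #|F|) (s_hi : #|F| < s.+1 ^ 2).
Hypothesis Pbig : forall f x, f \in P -> x \in U -> (x \in B) = (s < degree F (f x)).

Let k := #|F|.
(* All bounds are stated for squares, as the natural unit of cost is sqrt k. *)
Let bounded (D : {set T}) h := ntraces P D ^ 2 <= 4 ^ #|D| * k ^ h.

Let boundedU (D D' : {set T}) h h' : [disjoint D & D'] ->
  bounded D h -> bounded D' h' -> bounded (D :|: D') (h + h').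
Proof.
move=> dD bD bD'; rewrite /bounded cardsU disjoint_setI0 // cards0 subn0.
rewrite !expnD mulnACA; apply: leq_trans (leq_mul bD bD').
by rewrite -expnMn leq_exp2r // ntracesU.
Qed.

Let bounded0 : bounded set0 0.
Proof. by rewrite /bounded cards0 !expn0 muln1 -{2}(exp1n 2) leq_exp2r // ntraces0. Qed.

Let bounded_single x : x \in U -> bounded [set x] 2.
Proof.
move=> xU; rewrite /bounded cards1 (_ : 4 ^ 1 = 2 ^ 2)// -expnMn leq_exp2r //.
by rewrite mulnC; apply: ntraces_touch => f fP; apply: Ptouch.
Qed.

Let bounded_big x : x \in B -> bounded [set x] 1.
Proof.
move=> xB; rewrite /bounded cards1 !expn1.
apply: leq_trans (card_big_degree s_hi); rewrite leq_exp2r //.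
apply: leq_trans (ntraces1 _ _) _.
apply/subset_leq_card/subsetP => _ /imsetP[f fP ->].
by rewrite inE -(Pbig fP) // (subsetP sBU).
Qed.

Let bounded_edge x y : x \in U -> y \in U -> adj x y -> x != y ->
  bounded [set x; y] 2.
Proof.
move=> xU yU axy xy; rewrite /bounded cards2 xy.
apply: (@leq_trans ((k * 2) ^ 2)); last by rewrite expnMn mulnC leq_mul2r orbT.
by rewrite leq_exp2r // ntraces_edge // => f fP; apply: PF.
Qed.

Let bounded_many (D : {set T}) c : (forall x, x \in D -> bounded [set x] c) ->
  bounded D (#|D| * c).
Proof.
have [m] := ubnP #|D|; elim: m => // m IHm in D * => leDm Dc.
have [-> | [x xD]] := set_0Vmem D; first by rewrite cards0; apply: bounded0.
rewrite (cardsD1 x D) xD mulSn -{1}(setD1K xD); apply: boundedU.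
- by rewrite disjoints1 !inE eqxx.
- exact: Dc.
apply: IHm; first by move: leDm; rewrite (cardsD1 x D) xD.
by move=> y /setD1P[_ /Dc].
Qed.

Let bounded_matching (I : {set T}) (f : T -> T) : I \subset U ->
  {in I &, injective f} -> (forall x, x \in I -> f x \in U /\ adj x (f x)) ->
  [disjoint I & f @: I] -> bounded (I :|: f @: I) (#|I| * 2).
Proof.
have [m] := ubnP #|I|; elim: m => // m IHm in I * => leIm sIU f_inj fP dI.
have [-> | [x xI]] := set_0Vmem I.
  by rewrite imset0 setU0 cards0; apply: bounded0.
have fxI : f x \notin I by rewrite (disjointFl dI) // imset_f.
have xfI : x \notin f @: I by rewrite (disjointFr dI).
have eqI : I :|: f @: I = [set x; f x] :|: ((I :\ x) :|: f @: (I :\ x)).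
  by rewrite -{1 2}(setD1K xI) imsetU1 setUACA.
rewrite eqI (cardsD1 x I) xI mulSn; apply: boundedU.
- rewrite disjoints_subset; apply/subsetP => y; rewrite !inE.
  have sI : f @: (I :\ x) \subset f @: I by apply/imsetS/subD1set.
  case/orP=> /eqP ->; rewrite ?eqxx /=.
    by apply: contra xfI => /(subsetP sI).
  rewrite negb_or (negPf fxI) andbF /=; apply/imsetP => -[z /setD1P[zx zI]].
  by move/(f_inj _ _ xI zI)=> /eqP; rewrite eq_sym (negPf zx).
- have [fxU axf] := fP x xI; apply: bounded_edge => //.
    exact: (subsetP sIU).
  by apply: contraNneq fxI => <-.
have sI : I :\ x \subset I by apply: subD1set.
apply: IHm.
- by move: leIm; rewrite (cardsD1 x I) xI.
- exact: subset_trans sIU.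
- by move=> y z /(subsetP sI) yI /(subsetP sI); apply: f_inj.
- by move=> y /(subsetP sI); apply: fP.
exact: disjointW sI (imsetS f sI) dI.
Qed.

(* A component of small vertices is explored from one of its edges: the edge has
O(k) images, and each further vertex, as a neighbour of a known one, sqrt k. *)
Let bounded_small (D : {set T}) : D \subset U :\: B ->
  (forall x, x \in D -> exists2 y, y \in D & adj x y /\ x != y) -> bounded D #|D|.
Proof.
move=> sD Dadj.
have [D0 [sD0 bD0] maxD0] : exists2 D0 : {set T}, D0 \subset D /\ bounded D0 #|D0| &
    forall D1 : {set T}, D1 \subset D -> bounded D1 #|D1| -> #|D1| <= #|D0|.
  pose Q (X : {set T}) := (X \subset D) && (ntraces P X ^ 2 <= 4 ^ #|X| * k ^ #|X|).
  have Q0 : Q set0 by rewrite /Q sub0set /=; move: bounded0; rewrite /bounded cards0.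
  case: (@arg_maxnP _ set0 Q (fun X => #|X|) Q0) => X /andP[sX bX] maxX.
  by exists X => // Y sY bY; apply: maxX; rewrite /Q sY.
have [sDD0|/subsetPn[x xD xD0]] := boolP (D \subset D0).
  by have -> : D = D0 by apply/eqP; rewrite eqEsubset sDD0.
have [y yD [axy xy]] := Dadj x xD.
have DU z : z \in D -> z \in U /\ z \notin B.
  by move/(subsetP sD); rewrite inE => /andP[].
have [[xU xB] [yU yB]] := (DU x xD, DU y yD).
suff [D1 [sD1 bD1 lt]] : exists D1 : {set T},
    [/\ D1 \subset D, bounded D1 #|D1| & #|D0| < #|D1|].
  by have := maxD0 D1 sD1 bD1; rewrite leqNgt lt.
have [yD0|yD0] := boolP (y \in D0).
  exists (x |: D0); split; first by rewrite subUset sub1set xD.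
    rewrite /bounded cardsU1 xD0 add1n (expnSr 4) (expnSr k) mulnACA.
    apply: (@leq_trans (ntraces P D0 ^ 2 * s ^ 2)).
      rewrite -expnMn leq_exp2r // ; apply: (@ntraces_small _ _ _ F _ y) => // f fP.
      split; first by rewrite setUC; apply: PF; rewrite // adj_sym.
      by rewrite leqNgt -(Pbig fP).
    apply: leq_mul => //.
    by apply: leq_trans s_lo _; rewrite leq_pmull.
  by rewrite cardsU1 xD0.
have dis : [disjoint [set x; y] & D0].
  rewrite disjoints_subset; apply/subsetP => z; rewrite !inE.
  by case/orP=> /eqP ->.
exists ([set x; y] :|: D0); split.
- by rewrite subUset sD0 andbT; apply/subsetP => z; rewrite !inE => /orP[]/eqP->.
- have -> : #|[set x; y] :|: D0| = 2 + #|D0|.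
    by rewrite cardsU disjoint_setI0 // cards0 subn0 cards2 xy.
  by apply: boundedU => //; apply: bounded_edge.
by rewrite cardsU disjoint_setI0 // cards0 subn0 cards2 xy addSn ltnS leq_addl.
Qed.

Hypothesis adj_irr : forall x y, adj x y -> x != y.

(** The trace is cut into the small vertices with a small neighbour, which cost
sqrt k each, and the remaining small vertices L together with B. If J in L has
the largest deficiency #|J| - #|N(J)| in the bipartite graph between L and B,
then Hall's theorem matches N(J) into J, and L - J into B - N(J). Each matched
edge costs k, each other vertex of J costs k and each other vertex of B sqrt k.
The exponent of k in the square is then 2 for J, 0 for N(J) and 1 for each other
vertex, which is twice an admissible fractional independent assignment. *)
Lemma ntraces_bound_split : exists I N : {set T},
  [/\ I \subset U, N \subset U, [disjoint I & N],
      forall x y, x \in I -> y \in U -> adj x y -> y \in N &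
      ntraces P U ^ 2 <= 4 ^ #|U| * k ^ (#|U| + #|I| - #|N|)].
Proof.
pose Ssm := U :\: B.
pose L := [set x in Ssm | [forall y in Ssm, ~~ adj x y]].
(* The inequality says that J has the largest deficiency; it is written without
subtraction. *)
have [J sJL maxJ] : exists2 J : {set T}, J \subset L &
    forall A : {set T}, A \subset L ->
      #|A| + #|nbrs adj J B| <= #|J| + #|nbrs adj A B|.
  pose d (A : {set T}) := #|A| + (#|T| - #|nbrs adj A B|).
  case: (@arg_maxnP _ set0 (fun A : {set T} => A \subset L) d (sub0set _)) => J sJ maxJ.
  exists J => // A /maxJ; rewrite /d.
  have := subset_leq_card (subsetT (nbrs adj A B)).
  by have := subset_leq_card (subsetT (nbrs adj J B)); rewrite cardsT; lia.
set N := nbrs adj J B in maxJ *.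
have sNB : N \subset B by apply: nbrs_sub.
have LP x : x \in L -> [/\ x \in U, x \notin B &
    forall y, y \in U -> y \notin B -> ~~ adj x y].
  rewrite !inE => /andP[/andP[xB xU] /forall_inP xL]; split=> // y yU yB.
  by apply: xL; rewrite inE yB.
have sLU : L \subset U by apply/subsetP => x /LP[].
have dLB : [disjoint L & B].
  by rewrite disjoints_subset; apply/subsetP => x /LP[_]; rewrite inE.
(* Hall's condition for A in L - J: adding A to J cannot raise the deficiency. *)
have [f f_inj fP] : exists2 f : T -> T, {in L :\: J &, injective f} &
    forall x, x \in L :\: J -> f x \in B :\: N /\ adj x (f x).
  apply: hall => A sA; rewrite nbrsD.
  have := maxJ (J :|: A); rewrite subUset sJL (subset_trans sA (subsetDl _ _)).
  have dJA : [disjoint J & A].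
    by rewrite disjoint_sym; move: sA; rewrite subsetD => /andP[].
  move=> /(_ isT); rewrite cardsU disjoint_setI0 // cards0 subn0 nbrsU -/N.
  rewrite -(cardsID N (N :|: _)) setIUl setIid (setUidPl (subsetIr _ _)).
  rewrite setDUl setDv set0U.
  by move: #|J| #|N| #|A| #|_ :\: _| => nJ nN nA nD; clear; lia.
(* Hall's condition for A in N(J): removing the neighbours of A from J cannot
raise the deficiency either. *)
have [g g_inj gP] : exists2 g : T -> T, {in N &, injective g} &
    forall x, x \in N -> g x \in J /\ adj x (g x).
  apply: hall => A sA.
  have := maxJ (J :\: nbrs adj A J); rewrite (subset_trans (subsetDl _ _) sJL).
  have sN : nbrs adj (J :\: nbrs adj A J) B \subset N :\: A.
    apply/subsetP => y; rewrite !inE => /andP[yB /existsP[x /andP[]]].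
    rewrite !inE negb_and => /andP[/orP[/negP//|nxA] xJ] axy.
    rewrite yB /= andbC; apply/andP; split.
      by apply/existsP; exists x; rewrite xJ.
    apply: contra nxA => yA; apply/existsP; exists y; rewrite yA adj_sym.
    exact: axy.
  have := subset_leq_card sN; rewrite cardsDS // cardsDS ?nbrs_sub //.
  have := subset_leq_card (nbrs_sub adj A J); have := subset_leq_card sA.
  move: #|J| #|N| #|A| #|nbrs adj A J| #|nbrs adj _ _| => nJ nN nA n1 n2.
  by clear; lia.
exists J, N; split.
- exact: subset_trans sLU.
- exact: subset_trans sBU.
- exact: disjointW sJL sNB dLB.
- move=> x y xJ yU axy; have [_ _ xL] := LP _ (subsetP sJL _ xJ).
  rewrite inE; apply/andP; split.
    by apply: contraLR axy; apply: xL.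
  by apply/existsP; exists x; rewrite xJ.
pose fI := f @: (L :\: J); pose gN := g @: N.
have sfI : fI \subset B :\: N by apply/subsetP => _ /imsetP[x /fP[? _] ->].
have sgN : gN \subset J by apply/subsetP => _ /imsetP[x /gP[? _] ->].
have cardgN : #|gN| = #|N| by apply: card_in_imset.
have cardfI : #|fI| = #|L :\: J| by apply: card_in_imset.
have sgNL : gN \subset L := subset_trans sgN sJL.
have dNgN : [disjoint N & gN].
  by rewrite disjoint_sym; apply: disjointW dLB.
have bJ : bounded (N :|: J) (#|J| * 2).
  have -> : N :|: J = (N :|: gN) :|: (J :\: gN).
    by rewrite -setUA -{1}(setID J gN) (setIidPr sgN).
  have -> : #|J| * 2 = #|N| * 2 + #|J :\: gN| * 2.
    by rewrite -mulnDl cardsDS // cardgN subnKC // -cardgN subset_leq_card.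
  apply: boundedU; last first.
  - by apply: bounded_many => x /setDP[/(subsetP sJL)/(subsetP sLU)xU _]; apply: bounded_single.
  - apply: bounded_matching => // [|x xN]; first exact: subset_trans sBU.
    by have [/(subsetP sJL)/(subsetP sLU)] := gP x xN.
  - rewrite disjoint_sym disjoints_subset; apply/subsetP => x /setDP[xJ xgN].
    by rewrite in_setC in_setU (negPf xgN) orbF (disjointFr (disjointW sJL sNB dLB) xJ).
have bI : bounded ((L :\: J) :|: fI) (#|L :\: J| * 2).
  apply: bounded_matching => //.
  - by apply: subset_trans sLU; apply: subsetDl.
  - by move=> x /fP[/setDP[/(subsetP sBU) ? _] ?].
  by apply: disjointW dLB; [apply: subsetDl | apply: subset_trans sfI (subsetDl _ _)].
have bB : bounded (B :\: N :\: fI) (#|B :\: N :\: fI| * 1).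
  by apply: bounded_many => x /setDP[/setDP[xB _] _]; apply: bounded_big.
have bS : bounded (Ssm :\: L) #|Ssm :\: L|.
  apply: bounded_small => [|x]; first exact: subsetDl.
  move=> /setDP[xS]; rewrite inE xS /= negb_forall_in => /exists_inP[y yS].
  rewrite negbK => axy; exists y; last by split=> //; apply: adj_irr.
  rewrite inE yS andbT inE yS /= negb_forall_in; apply/exists_inP.
  by exists x; rewrite // negbK adj_sym.
have sLS : L \subset Ssm by apply/subsetP => x /setIdP[].
have subE (A C : {set T}) x : A \subset C -> (x \in A) ==> (x \in C).
  by move/subsetP=> sAC; apply/implyP => /sAC.
have dLBx x : ~~ ((x \in L) && (x \in B)).
  by apply/negP => /andP[xL]; rewrite (disjointFr dLB xL).
have U_split : U = ((N :|: J) :|: ((L :\: J) :|: fI)) :|: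
                   ((B :\: N :\: fI) :|: (Ssm :\: L)).
  apply/setP => x; move: (subE _ _ x sBU) (subE _ _ x sNB) (subE _ _ x sfI).
  move: (subE _ _ x sJL) (subE _ _ x sLS) => {bJ bI bB bS}.
  rewrite !(in_setU, in_setD).
  by case: (x \in U); case: (x \in B); case: (x \in N); case: (x \in J);
    case: (x \in L); case: (x \in fI).
have cardS : #|Ssm| = #|U| - #|B| by rewrite cardsDS.
have [leNB leBU] := (subset_leq_card sNB, subset_leq_card sBU).
have [leJL leLS] := (subset_leq_card sJL, subset_leq_card sLS).
have lefI := subset_leq_card sfI.
have [cLJ cBN cBNI cSL] : [/\ #|L :\: J| = #|L| - #|J|, #|B :\: N| = #|B| - #|N|,
    #|B :\: N :\: fI| = #|B| - #|N| - #|fI| & #|Ssm :\: L| = #|Ssm| - #|L|].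
  by rewrite !cardsDS.
have := boundedU _ (boundedU _ bJ bI) (boundedU _ bB bS); rewrite -U_split.
have -> : #|J| * 2 + #|L :\: J| * 2 + (#|B :\: N :\: fI| * 1 + #|Ssm :\: L|) =
    #|U| + #|J| - #|N|.
  move: leNB leBU leJL leLS lefI; rewrite cBNI cSL cBN cardS cardfI cLJ.
  by move: #|N| #|B| #|U| #|J| #|L| => nN nB nU nJ nL; clear; lia.
have disj x : [/\ ~~ ((x \in N :|: J) && (x \in (L :\: J) :|: fI)),
    ~~ ((x \in (N :|: J) :|: ((L :\: J) :|: fI)) &&
        (x \in (B :\: N :\: fI) :|: (Ssm :\: L))) &
    ~~ ((x \in B :\: N :\: fI) && (x \in Ssm :\: L))].
  move: (subE _ _ x sBU) (subE _ _ x sNB) (subE _ _ x sfI).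
  move: (subE _ _ x sJL) (subE _ _ x sLS) (dLBx x) => {bJ bI bB bS}.
  rewrite !(in_setU, in_setD).
  by case: (x \in U); case: (x \in B); case: (x \in N); case: (x \in J);
    case: (x \in L); case: (x \in fI).
apply; rewrite disjoints_subset; apply/subsetP => x xA; rewrite in_setC;
  by have [] := disj x; rewrite xA.
Qed.

End TraceBound.

(** * Random subsets with independent elements *)

Local Open Scope ring_scope.

Section RandomSubset.
Variables (R : realFieldType) (U : finType).
Implicit Types (p q : U -> R) (S A F : {set U}).

Definition bmass q S : R := \prod_u (if u \in S then q u else 1 - q u).

Lemma bmass_ge0 q S : (forall u, 0 <= q u <= 1) -> 0 <= bmass q S.
Proof.
move=> q01; apply: prodr_ge0 => u _; have /andP[q0 q1] := q01 u.
by case: ifP => // _; rewrite subr_ge0.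
Qed.

Lemma sum_bmass_sup q A : \sum_(S : {set U} | A \subset S) bmass q S = \prod_(u in A) q u.
Proof.
pose g u : R := if u \in A then 0 else 1 - q u.
transitivity (\sum_(S in {set U}) \prod_u (if u \in S then q u else g u)).
  rewrite big_mkcond /=; apply: eq_bigr => S _; case: ifPn => [sAS|].
    apply: eq_bigr => u _; case: ifPn => // uS; rewrite /g ifN //.
    by apply: contra uS => /(subsetP sAS).
  by case/subsetPn=> u uA uS; rewrite (bigD1 u) //= (negPf uS) /g uA mul0r.
rewrite -bigA_distr [RHS]big_mkcond; apply: eq_bigr => u _.
by rewrite /g /=; case: ifP => _; rewrite ?addr0 // addrC subrK.
Qed.

Lemma sum_bmass q : \sum_S bmass q S = 1.
Proof.
transitivity (\sum_(S : {set U} | set0 \subset S) bmass q S).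
  by apply: eq_bigl => S; rewrite sub0set.
by rewrite sum_bmass_sup big_set0.
Qed.

Lemma bmass_event_le1 q (X : pred {set U}) : (forall u, 0 <= q u <= 1) ->
  \sum_(S | X S) bmass q S <= 1.
Proof.
move=> q01; rewrite -(sum_bmass q) [leRHS](bigID X) /= lerDl.
by apply: sumr_ge0 => S _; apply: bmass_ge0.
Qed.

Lemma bmass_event_sup q (X : pred {set U}) A : (forall u, 0 <= q u <= 1) ->
  (forall S, A \subset S -> X S) -> \prod_(u in A) q u <= \sum_(S | X S) bmass q S.
Proof.
move=> q01 AX; rewrite -sum_bmass_sup [leRHS](bigID (fun S => A \subset S)) /=.
rewrite [X in _ <= X + _](eq_bigl (fun S => A \subset S)) => [|S]; last first.
  by case sAS: (A \subset S); rewrite ?andbF // AX.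
by rewrite lerDl; apply: sumr_ge0 => S _; apply: bmass_ge0.
Qed.

(** Cauchy-Schwarz for the likelihood ratio of q and p, whose second moment under
p is the product. It is used in the form 2 l Q <= l ^ 2 P + V, which follows
term by term from the inequality of means, at l = Q / P. *)
Lemma change_of_measure p q (X : pred {set U}) :
  (forall u, 0 <= p u < 1) -> (forall u, p u = 0 -> q u = 0) ->
  (forall u, 0 <= q u <= 1) ->
  (\sum_(S | X S) bmass q S) ^+ 2 <=
    (\sum_(S | X S) bmass p S) *
      \prod_u (q u ^+ 2 / p u + (1 - q u) ^+ 2 / (1 - p u)).
Proof.
move=> p01 pq q01.
have p01' u : 0 <= p u <= 1 by have /andP[-> /ltW] := p01 u.
set Q := \sum_(S | X S) bmass q S; set P := \sum_(S | X S) bmass p S.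
set V := \prod_u _.
have VE : V = \sum_S bmass q S ^+ 2 / bmass p S.
  rewrite /V bigA_distr; apply: eq_bigr => S _.
  rewrite /bmass -prodrXl -prodf_div; apply: eq_bigr => u _.
  by case: ifP.
have Q0 : 0 <= Q by apply: sumr_ge0 => S _; apply: bmass_ge0.
have P0 : 0 <= P by apply: sumr_ge0 => S _; apply: bmass_ge0.
have amgm (l : R) : 0 < l -> 2 * l * Q <= l ^+ 2 * P + V.
  move=> l0; rewrite VE /Q /P !mulr_sumr [Y in _ <= _ + Y](bigID X) /= addrA.
  rewrite -big_split /=.
  rewrite -[leLHS]addr0; apply: lerD; last first.
    apply: sumr_ge0 => S _; rewrite divr_ge0 ?sqr_ge0 ?bmass_ge0 //.
  apply: ler_sum => S _.
  have [pS0|pS0] := eqVneq (bmass p S) 0.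
    suff -> : bmass q S = 0 by rewrite pS0 !(mulr0, mul0r, expr0n) /= addr0.
    move/eqP: pS0; rewrite /bmass prodf_seq_eq0 => /hasP[u _ /= /eqP pu].
    apply/eqP; rewrite prodf_seq_eq0; apply/hasP; exists u; rewrite ?mem_index_enum //=.
    move: pu; case: ifP => uS; first by move/pq ->.
    by move/eqP; rewrite subr_eq0 => /eqP pu; have := p01 u; rewrite -pu ltxx andbF.
  have pS : 0 < bmass p S by rewrite lt0r pS0 bmass_ge0.
  rewrite -subr_ge0 (_ : _ - _ = (l * bmass p S - bmass q S) ^+ 2 / bmass p S).
    by rewrite divr_ge0 ?sqr_ge0 // ltW.
  by field.
have V0 : 0 <= V.
  by rewrite VE; apply: sumr_ge0 => S _; rewrite divr_ge0 ?sqr_ge0 ?bmass_ge0.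
have [P00|P00] := eqVneq P 0.
  suff -> : Q = 0 by rewrite P00 mul0r expr0n.
  apply/eqP; rewrite eq_le Q0 andbT leNgt; apply/negP => Qpos.
  have /amgm : 0 < (V + 1) / Q by rewrite divr_gt0 // ltr_wpDl.
  by rewrite P00 mulr0 add0r -mulrA divfK ?gt_eqF //; lra.
have Ppos : 0 < P by rewrite lt0r P00.
have [->|Q00] := eqVneq Q 0; first by rewrite expr0n mulr_ge0.
have Qpos : 0 < Q by rewrite lt0r Q00.
have /amgm : 0 < Q / P by rewrite divr_gt0.
rewrite -(ler_pM2l Ppos) (_ : P * (2 * (Q / P) * Q) = 2 * Q ^+ 2); last by field.
rewrite (_ : P * ((Q / P) ^+ 2 * P + V) = Q ^+ 2 + P * V); last by field.
by rewrite mulr_natl mulr2n lerD2l.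
Qed.

Section Counting.
Variables (I : finType) (K : {set I}) (e : I -> {set U}).

Definition ncontained S : nat := #|[set i in K | e i \subset S]|.

Lemma ncontainedE S : (ncontained S)%:R = \sum_(i in K) ((e i \subset S)%:R : R).
Proof.
rewrite /ncontained -sum1_card natr_sum.
rewrite (eq_bigl (fun i => (i \in K) && (e i \subset S))) => [|i].
  by rewrite big_mkcondr /=; apply: eq_bigr => i _; case: ifP.
by rewrite inE.
Qed.

Lemma sum_bmass_ncontained q (g : {set U} -> R) :
  \sum_S bmass q S * g S * (ncontained S)%:R =
  \sum_(i in K) \sum_(S : {set U} | e i \subset S) bmass q S * g S.
Proof.
under eq_bigr do rewrite ncontainedE mulr_sumr.
rewrite exchange_big; apply: eq_bigr => i _; rewrite [RHS]big_mkcond /=.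
by apply: eq_bigr => S _; case: ifP => _; rewrite ?mulr1 ?mulr0.
Qed.

Lemma mean_ncontained q :
  \sum_S bmass q S * (ncontained S)%:R = \sum_(i in K) \prod_(u in e i) q u.
Proof.
under eq_bigr do rewrite -[bmass q _]mulr1.
rewrite sum_bmass_ncontained; apply: eq_bigr => i _; rewrite -sum_bmass_sup.
by apply: eq_bigr => S _; rewrite mulr1.
Qed.

Lemma ncontained_le S : (ncontained S <= #|K|)%N.
Proof. by apply/subset_leq_card/subsetP => i; rewrite inE => /andP[]. Qed.

(** The number of contained members is at most #|K|, so a mean above l forces a
substantial probability of reaching l. *)
Lemma ncontained_ge_prob q (l : R) : (forall u, 0 <= q u <= 1) -> 0 <= l ->
  \sum_(i in K) \prod_(u in e i) q u - l <=
    #|K|%:R * \sum_(S | l <= (ncontained S)%:R) bmass q S.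
Proof.
move=> q01 l0; rewrite -mean_ncontained lerBlDl.
rewrite (bigID (fun S => l <= (ncontained S)%:R)) /= addrC mulr_sumr; apply: lerD.
  apply: (@le_trans _ _ (\sum_(S | ~~ (l <= (ncontained S)%:R)) bmass q S * l)).
    by apply: ler_sum => S; rewrite -ltNge => /ltW ?; rewrite ler_wpM2l ?bmass_ge0.
  by rewrite -mulr_suml ler_piMl // bmass_event_le1.
apply: ler_sum => S _; rewrite mulrC ler_wpM2r ?bmass_ge0 //.
by rewrite ler_nat ncontained_le.
Qed.

(** The partial moments are bounded on the event that A is contained in the random
set, by induction on the number j of factors: summing over the next member i
replaces A by its union with e i, at the cost of the product of q over e i - A,
whose sum over i is at most B by assumption. *)
Lemma moment_bound q (d m : nat) (B : R) : (forall u, 0 <= q u <= 1) ->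
  (forall i, i \in K -> (#|e i| <= d)%N) ->
  (forall F, (#|F| <= m.-1 * d)%N ->
     \sum_(i in K) \prod_(u in e i :\: F) q u <= B) ->
  \sum_S bmass q S * (ncontained S)%:R ^+ m <= B ^+ m.
Proof.
move=> q01 ed FB.
have prod_ge0 A : 0 <= \prod_(u in A) q u.
  by apply: prodr_ge0 => u _; have /andP[] := q01 u.
suff H j A : (#|A| + j * d <= m * d)%N ->
    \sum_(S : {set U} | A \subset S) bmass q S * (ncontained S)%:R ^+ j <=
    \prod_(u in A) q u * B ^+ j.
  have := H m set0; rewrite cards0 add0n big_set0 mul1r => /(_ (leqnn _)).
  by under eq_bigl do rewrite sub0set.
elim: j A => [|j IHj] A leA.
  rewrite expr0 mulr1 -sum_bmass_sup; under eq_bigr do rewrite expr0 mulr1.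
  exact: lexx.
have leAF : (#|A| <= m.-1 * d)%N.
  have [m0|m0] := posnP m; first by move: leA; rewrite m0 mul0n; lia.
  by move: leA; rewrite -{1}(prednK m0) !mulSn; lia.
have B0 : 0 <= B.
  apply: le_trans (FB set0 _); last by rewrite cards0.
  by apply: sumr_ge0 => i _; apply: prod_ge0.
rewrite (_ : \sum_(S | _) _ = \sum_S bmass q S *
    ((A \subset S)%:R * (ncontained S)%:R ^+ j) * (ncontained S)%:R); last first.
  rewrite big_mkcond /=; apply: eq_bigr => S _.
  by case: ifP => _; rewrite ?mul1r ?mul0r ?mulr0 ?mul0r // exprSr mulrA.
rewrite (sum_bmass_ncontained q (fun S => (A \subset S)%:R * (ncontained S)%:R ^+ j)).
apply: (@le_trans _ _ (\sum_(i in K)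
    (\prod_(u in A) q u * \prod_(u in e i :\: A) q u) * B ^+ j)).
  apply: ler_sum => i iK;   have -> : \prod_(u in A) q u * \prod_(u in e i :\: A) q u = \prod_(u in A :|: e i) q u.
    by rewrite [RHS](big_setID A) /= setIUl setIid (setUidPl (subsetIr _ _))
      setDUl setDv set0U.
  apply: le_trans (IHj (A :|: e i) _).
    rewrite [leLHS]big_mkcond [leRHS]big_mkcond /=; apply: ler_sum => S _.
    rewrite subUset; case: (e i \subset S); rewrite ?andbF //=.
    by case: (A \subset S); rewrite ?mul1r // mul0r mulr0.
  apply: leq_trans leA; rewrite mulSn addnA leq_add2r.
  by rewrite (leq_trans (leq_card_setU _ _)) // leq_add2l ed.
rewrite -mulr_suml -mulr_sumr -mulrA exprS ler_wpM2l ?prod_ge0 //.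
by rewrite ler_wpM2r ?exprn_ge0 // FB.
Qed.

Lemma ncontained_tail q (d m : nat) (B l : R) : (forall u, 0 <= q u <= 1) -> 0 < l ->
  (forall i, i \in K -> (#|e i| <= d)%N) ->
  (forall F, (#|F| <= m.-1 * d)%N ->
     \sum_(i in K) \prod_(u in e i :\: F) q u <= B) ->
  \sum_(S | l <= (ncontained S)%:R) bmass q S <= (B / l) ^+ m.
Proof.
move=> q01 l0 ed FB; rewrite expr_div_n ler_pdivlMr ?exprn_gt0 //.
apply: le_trans (moment_bound q01 ed FB); rewrite mulr_suml.
rewrite [leRHS](bigID (fun S => l <= (ncontained S)%:R)) /=.
rewrite -[leLHS]addr0; apply: lerD; last first.
  by apply: sumr_ge0 => S _; rewrite mulr_ge0 ?bmass_ge0 ?exprn_ge0.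
apply: ler_sum => S lS; rewrite ler_wpM2l ?bmass_ge0 //.
by rewrite lerXn2r ?nnegrE ?(ltW l0).
Qed.

End Counting.
End RandomSubset.

(** * Copies and embeddings *)

Section GraphFacts.
Variable T : finType.
Implicit Types (G : graph T) (e : {set T}).

Lemma edgeP G e : e \in edges G -> e \subset vertices G /\ #|e| = 2%N.
Proof.
move=> eG; have /forall_inP/(_ e eG)/andP[-> /eqP ->] // :
  is_graph (graph_val G) by case: G {eG}.
Qed.

Lemma graph_eqP G G' : vertices G = vertices G' -> edges G = edges G' -> G = G'.
Proof. by move=> eqV eqE; apply: val_inj; apply/eqP; rewrite -pair_eqE; apply/andP; split; apply/eqP. Qed.

Lemma imset_inj_sub (S : finType) (f : T -> S) (A B C : {set T}) :
  {in A &, injective f} -> B \subset A -> C \subset A -> f @: B = f @: C -> B = C.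
Proof.
move=> f_inj sB sC eqf.
have H (D E : {set T}) : D \subset A -> E \subset A -> f @: D = f @: E -> D \subset E.
  move=> sD sE eqDE; apply/subsetP => x xD.
  have : f x \in f @: E by rewrite -eqDE imset_f.
  case/imsetP=> y yE /f_inj -> //; first exact: (subsetP sD).
  exact: (subsetP sE).
apply/eqP; rewrite eqEsubset (H B C sB sC eqf).
by rewrite (H C B sC sB (esym eqf)).
Qed.

End GraphFacts.

Section GnpLink.
Variables (R : realType) (n : nat).
Implicit Types (p : R) (S : {set {set 'I_n}}).

(** Edge weights of G(n,p) on all vertex subsets, so that an arbitrary set of
vertex subsets is a legitimate outcome, of probability 0 if it has a member
that is not a pair. *)
Definition pair_weight p (u : {set 'I_n}) : R := if #|u| == 2%N then p else 0.

Lemma pair_weight01 p : 0 <= p <= 1 -> forall u, 0 <= pair_weight p u <= 1.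
Proof. by move=> p01 u; rewrite /pair_weight; case: ifP => // _; rewrite lexx ler01. Qed.

Definition pairs : {set {set 'I_n}} := [set u : {set 'I_n} | #|u| == 2%N].

Lemma card_pairs : #|pairs| = 'C(n, 2).
Proof. by rewrite card_draws card_ord. Qed.

Lemma gnp_massE p (F : graph 'I_n) :
  gnp_mass p F = bmass (pair_weight p) (edges F).
Proof.
rewrite /bmass (bigID (fun u => u \in edges F)) /=; congr (_ * _).
  rewrite (eq_bigr (fun=> p)) => [|u uF]; first by rewrite prodr_const.
  by rewrite uF /pair_weight; have [_ ->] := edgeP uF.
rewrite (bigID (fun u : {set 'I_n} => #|u| == 2%N)) /= [X in _ = _ * X]big1 => [|u /andP[uF u2]]; last first.
  by rewrite (negPf uF) /pair_weight (negPf u2) subr0.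
rewrite mulr1 (eq_bigr (fun=> 1 - p)) => [|u /andP[uF u2]]; last first.
  by rewrite (negPf uF) /pair_weight u2.
rewrite prodr_const /ne -card_pairs; congr (_ ^+ _).
rewrite -cardsDS; last by apply/subsetP => u /edgeP[_]; rewrite inE => ->.
by rewrite -cardsE; apply: eq_card => u; rewrite !inE.
Qed.

Lemma bmass_nonpair p S u : u \in S -> #|u| != 2%N -> bmass (pair_weight p) S = 0.
Proof. by move=> uS u2; rewrite /bmass (bigD1 u) //= uS /pair_weight (negPf u2) mul0r. Qed.

Lemma empty_is_graph : is_graph (set0 : {set 'I_n}, set0).
Proof. by apply/forall_inP => e; rewrite inE. Qed.

Lemma full_is_graph S : is_graph (setT, S) = (S \subset pairs).
Proof.
by apply/forall_inP/subsetP => H e /H; rewrite inE /= ?subsetT // => /andP[].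
Qed.

(** This identifies G(n,p) with a random subset of the set of all vertex sets. *)
Lemma sum_gnp_mass p (g : {set {set 'I_n}} -> R) :
  \sum_(F : graph 'I_n | vertices F == setT) gnp_mass p F * g (edges F) =
  \sum_S bmass (pair_weight p) S * g S.
Proof.
pose h S : graph 'I_n := insubd (Graph empty_is_graph) (setT, S).
rewrite [RHS](bigID (fun S : {set {set 'I_n}} => S \subset pairs)) /=.
rewrite [X in _ = _ + X]big1 => [|S]; last first.
  by case/subsetPn=> u uS; rewrite inE => u2; rewrite (bmass_nonpair _ uS u2) mul0r.
rewrite addr0 [RHS](reindex_onto (@edges _) h) /= => [|S sS]; last first.
  by rewrite /edges /h val_insubd full_is_graph sS.
apply: eq_big => [F|F _]; last by rewrite gnp_massE.
have sF : edges F \subset pairs.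
  by apply/subsetP => u /edgeP[_]; rewrite inE => ->.
rewrite sF /=; apply/eqP/eqP => [VF|<-].
  by apply: graph_eqP; rewrite /vertices /edges /h val_insubd full_is_graph sF.
by rewrite /vertices /h val_insubd full_is_graph sF.
Qed.

End GnpLink.

Section Copies.
Variables (R : realType) (T : finType) (W : {set T}) (G : graph T) (n : nat).
Hypothesis WG : rooted W G.

Definition roots : {set 'I_n} := [set i : 'I_n | (i < #|W|)%N].
Definition copies : {set graph 'I_n} := [set K | rooted_iso W G roots K].
Definition ncop (S : {set {set 'I_n}}) : nat := ncontained copies (@edges _) S.

Lemma copiesP K : K \in copies -> exists f : {ffun T -> 'I_n},
  [/\ {in vertices G &, injective f}, f @: vertices G = vertices K,
      [set f @: (e : {set T}) | e in edges G] = edges K & f @: W = roots].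
Proof.
rewrite inE => /existsP[f /and4P[/dinjectiveP f_inj /eqP fV /eqP fE /eqP fW]].
by exists f; split.
Qed.

Lemma imset_edges_inj (f : T -> 'I_n) : {in vertices G &, injective f} ->
  {in edges G &, injective (fun e : {set T} => f @: e)}.
Proof.
by move=> f_inj e e' /edgeP[eV _] /edgeP[eV' _]; apply: (imset_inj_sub f_inj).
Qed.

Lemma ne_copy K : K \in copies -> ne K = ne G.
Proof.
case/copiesP=> f [f_inj _ fE _]; rewrite /ne -fE card_in_imset //.
exact: imset_edges_inj.
Qed.

Lemma nv_copy K : K \in copies -> nv K = nv G.
Proof. by case/copiesP=> f [f_inj fV _ _]; rewrite /nv -fV card_in_imset. Qed.

Lemma prod_copy (p : R) K : K \in copies ->
  \prod_(u in edges K) pair_weight p u = p ^+ ne G.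
Proof.
move=> /ne_copy <-; rewrite (eq_bigr (fun=> p)) => [|u /edgeP[_ u2]].
  by rewrite prodr_const.
by rewrite /pair_weight u2.
Qed.

Lemma ncopiesE (F : graph 'I_n) : vertices F == setT ->
  ncopies W G F = ncop (edges F).
Proof.
move/eqP=> FT; apply: eq_card => K; rewrite !inE /subgraph FT subsetT /=.
by rewrite andbC.
Qed.

Lemma muE (p : R) : mu W G n p = #|copies|%:R * p ^+ ne G.
Proof.
rewrite /mu /gnp_mean.
rewrite (eq_bigr (fun F : graph 'I_n => gnp_mass p F * (ncop (edges F))%:R)); last first.
  by move=> F VF; rewrite ncopiesE.
rewrite (sum_gnp_mass p (fun S => (ncop S)%:R)) mean_ncontained.
rewrite (eq_bigr (fun=> p ^+ ne G)) ?sumr_const ?mulr_natl // => K.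
exact: prod_copy.
Qed.

Lemma upper_tailE (p t : R) :
  upper_tail W G n p t =
  \sum_(S | t * (#|copies|%:R * p ^+ ne G) <= (ncop S)%:R) bmass (pair_weight p) S.
Proof.
rewrite /upper_tail /gnp_prob muE.
set l := t * _.
rewrite [RHS]big_mkcond /=.
transitivity (\sum_S bmass (pair_weight p) S * (l <= (ncop S)%:R :> R)%:R).
  rewrite -sum_gnp_mass big_mkcondr /=; apply: eq_bigr => F VF.
  by rewrite ncopiesE //; case: ifP; rewrite ?mulr1 ?mulr0.
by apply: eq_bigr => S _; case: ifP; rewrite ?mulr1 ?mulr0.
Qed.

End Copies.

Section Embeddings.
Variables (R : realType) (T : finType) (W : {set T}) (G : graph T) (n : nat) (d : 'I_n).
Hypothesis WG : rooted W G.

Definition edge_image (f : {ffun T -> 'I_n}) (J : {set {set T}}) : {set {set 'I_n}} :=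
  [set f @: (e : {set T}) | e in J].

(** The fixed value d outside of the vertices of G makes an embedding determined by
its restriction to them. *)
Definition embs : {set {ffun T -> 'I_n}} :=
  [set f : {ffun T -> 'I_n} | [&& dinjectiveb f (vertices G), f @: W == roots W n &
               [forall x, (x \notin vertices G) ==> (f x == d)]]].

Lemma embsP f : f \in embs -> [/\ {in vertices G &, injective f}, f @: W = roots W n &
  forall x, x \notin vertices G -> f x = d].
Proof.
rewrite inE => /and3P[/dinjectiveP f_inj /eqP fW /forallP fd]; split=> // x xV.
by have := fd x; rewrite xV => /eqP.
Qed.

Lemma edge_image_card2 (f : {ffun T -> 'I_n}) (e : {set T}) : {in vertices G &, injective f} -> e \in edges G -> #|f @: e| = 2%N.
Proof.
move=> f_inj eG; have [eV <-] := edgeP eG; apply: card_in_imset => x y xe ye.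
by apply: f_inj; apply: (subsetP eV).
Qed.

Lemma copy_is_graph f : f \in embs ->
  is_graph (f @: vertices G, edge_image f (edges G)).
Proof.
case/embsP=> f_inj _ _; apply/forall_inP => _ /imsetP[e eG ->] /=.
by rewrite (edge_image_card2 f_inj eG) imsetS //; have [] := edgeP eG.
Qed.

Definition copy_of (f : {ffun T -> 'I_n}) : graph 'I_n :=
  insubd (Graph (@empty_is_graph n)) (f @: vertices G, edge_image f (edges G)).

Lemma copy_ofE f : f \in embs ->
  vertices (copy_of f) = f @: vertices G /\ edges (copy_of f) = edge_image f (edges G).
Proof.
by move=> fE; rewrite /vertices /edges /copy_of val_insubd copy_is_graph.
Qed.

Lemma copy_of_copies f : f \in embs -> copy_of f \in copies W G n.
Proof.
move=> fE; have [f_inj fW _] := embsP fE; have [fV fE'] := copy_ofE fE.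
rewrite inE; apply/existsP; exists f; rewrite fV fE' /edge_image fW !eqxx /= andbT.
exact/dinjectiveP.
Qed.

Lemma ntraces_embs (P : {set {ffun T -> 'I_n}}) : P \subset embs ->
  (#|P| <= ntraces P (vertices G))%N.
Proof.
move=> sP; rewrite -ntracesT -(setUCr (vertices G)).
apply: leq_trans (ntracesU _ _ _) _; rewrite -[leqRHS]muln1 leq_mul2l.
apply/orP; right; rewrite -[leqRHS](exp1n #|~: vertices G|).
apply: ntraces_pow => x; rewrite inE => xV.
apply: leq_trans (ntraces1 _ _) _; rewrite -(cards1 d).
apply/subset_leq_card/subsetP => _ /imsetP[f /(subsetP sP)/embsP[_ _ fd] ->].
by rewrite inE fd.
Qed.

Lemma ntraces_img (P : {set {ffun T -> 'I_n}}) (D : {set T}) (Y : {set 'I_n}) :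
  (forall f x, f \in P -> x \in D -> f x \in Y) -> (ntraces P D <= #|Y| ^ #|D|)%N.
Proof.
move=> PY; apply: ntraces_pow => x xD; apply: leq_trans (ntraces1 _ _) _.
apply/subset_leq_card/subsetP => _ /imsetP[f fP ->]; exact: PY.
Qed.

(** A copy K is the image of at least one embedding, and of at most v ^ v, as these
map the v vertices of G to those of K. Hence copies may be replaced by
embeddings up to constants. *)
Lemma sum_embs_copies (g : {set {set 'I_n}} -> R) : (forall S, 0 <= g S) ->
  \sum_(K in copies W G n) g (edges K) <= \sum_(f in embs) g (edge_image f (edges G)) /\
  \sum_(f in embs) g (edge_image f (edges G)) <=
    (nv G ^ nv G)%:R * \sum_(K in copies W G n) g (edges K).
Proof.
move=> g0.
pose fib K := [set f in embs | copy_of f == K].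
have -> : \sum_(f in embs) g (edge_image f (edges G)) =
    \sum_(K in copies W G n) (#|fib K|)%:R * g (edges K).
  rewrite (partition_big copy_of (mem (copies W G n))) /=; last exact: copy_of_copies.
  apply: eq_bigr => K KC; rewrite (eq_bigr (fun=> g (edges K))).
    rewrite sumr_const mulr_natl; congr (_ *+ _).
    by apply: eq_card => f; rewrite [RHS]in_set unfold_in.
  by move=> f /andP[fE /eqP <-]; have [_ ->] := copy_ofE fE.
split.
  apply: ler_sum => K KC; rewrite ler_peMl // ler1n card_gt0.
  have [f [f_inj fV fE fW]] := copiesP KC.
  pose f' : {ffun T -> 'I_n} := [ffun x => if x \in vertices G then f x else d].
  have eqf (A : {set T}) : A \subset vertices G -> f' @: A = f @: A.
    by move=> sA; apply: eq_in_imset => x /(subsetP sA) xV; rewrite ffunE xV.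
  have f'E : f' \in embs.
    rewrite inE eqf ?fW ?eqxx //=; last by case: WG.
    apply/andP; split.
      by apply/dinjectiveP => x y xV yV; rewrite !ffunE xV yV; apply: f_inj.
    by apply/forallP => x; apply/implyP => /negPf xV; rewrite ffunE xV.
  apply/set0Pn; exists f'; rewrite inE f'E; apply/eqP.
  have [V' E'] := copy_ofE f'E; apply: graph_eqP; first by rewrite V' eqf.
  rewrite E' -fE; apply: eq_in_imset => e /edgeP[eV _]; exact: eqf.
rewrite mulr_sumr; apply: ler_sum => K KC; rewrite ler_wpM2r // ler_nat.
have sfib : fib K \subset embs by apply/subsetP => f /setIdP[].
apply: leq_trans (ntraces_embs sfib) _.
rewrite -{1}(nv_copy KC).
apply: (@ntraces_img _ (vertices G) (vertices K)) => f x /setIdP[fE /eqP <-] xV.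
by have [-> _] := copy_ofE fE; apply: imset_f.
Qed.

Lemma card_copies_embs :
  (#|copies W G n| <= #|embs|)%N /\ (#|embs| <= nv G ^ nv G * #|copies W G n|)%N.
Proof.
have [] := @sum_embs_copies (fun=> 1) (fun=> ler01).
by rewrite !sumr_const -natrM !ler_nat.
Qed.

Lemma ntraces_roots (P : {set {ffun T -> 'I_n}}) : (#|W| <= n)%N -> P \subset embs ->
  (ntraces P W <= #|W| ^ #|W|)%N.
Proof.
move=> Wn sP; have -> : (#|W| ^ #|W| = #|roots W n| ^ #|W|)%N.
  congr (_ ^ _)%N; rewrite -sum1dep_card.
  by rewrite -(big_ord_widen n (fun=> 1%N)) // sum1_card card_ord.
apply: ntraces_img => f x /(subsetP sP)/embsP[_ <- _]; exact: imset_f.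
Qed.

(** The roots contribute a constant, and every vertex outside of W and U at most a
factor n. *)
Lemma card_embs_trace (P : {set {ffun T -> 'I_n}}) (U : {set T}) :
  P \subset embs -> U \subset vertices G :\: W -> (#|W| <= n)%N ->
  (#|P| <= #|W| ^ #|W| * n ^ (nv G - #|W| - #|U|) * ntraces P U)%N.
Proof.
move=> sP sU Wn; apply: leq_trans (ntraces_embs sP) _.
have [WV _] := WG.
have -> : vertices G = W :|: (((vertices G :\: W) :\: U) :|: U).
  apply/setP => x; have xWV := subsetP WV x; have xUV := subsetP sU x.
  move: xWV xUV; rewrite !in_setU !in_setD.
  by case: (x \in W) => [-> //|_]; case: (x \in U) => [xV|_];
    rewrite ?orbT ?orbF //; apply: xV.
apply: leq_trans (ntracesU _ _ _) _; rewrite -mulnA leq_mul ?ntraces_roots //.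
apply: leq_trans (ntracesU _ _ _) _; rewrite leq_mul2r; apply/orP; right.
have -> : (nv G - #|W| - #|U| = #|(vertices G :\: W) :\: U|)%N.
  by rewrite cardsDS // cardsDS.
rewrite -[X in (_ <= X ^ _)%N]card_ord -cardsT.
by apply: ntraces_img => f x _ _; rewrite inE.
Qed.

Lemma card_embs_le : (#|W| <= n)%N -> (#|embs| <= #|W| ^ #|W| * n ^ (nv G - #|W|))%N.
Proof.
move=> Wn; have := card_embs_trace (subxx embs) (sub0set _) Wn.
rewrite cards0 subn0 => /leq_trans; apply; rewrite -[leqRHS]muln1.
by rewrite leq_mul2l ntraces0 orbT.
Qed.

End Embeddings.

(** * Counting partial embeddings by fractional independence *)

Section FractionalIndependence.
Variables (R : realType) (T : finType).
Implicit Types (H : graph T) (x : T -> R).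

Let values H : classical_sets.set R := [set s | exists2 x : T -> R, frac_indep_assignment H x &
                 s = \sum_(i in vertices H) x i]%classic.

Lemma frac_indep_has_sup H : classical_sets.nonempty (values H) /\ ubound (values H) (nv H)%:R.
Proof.
split.
  exists 0, (fun=> 0); last by rewrite big1.
  by split=> [i _|i j _]; rewrite ?addr0 ?lexx ler01.
move=> _ [x [x01 _] ->]; rewrite -sumr_const.
by apply: ler_sum => i /x01/andP[].
Qed.

Lemma frac_indep_ge H x : frac_indep_assignment H x ->
  \sum_(i in vertices H) x i <= frac_indep R H.
Proof.
move=> Hx; have [_ ub] := frac_indep_has_sup H.
by apply: ub_le_sup; [exists (nv H)%:R | exists x].
Qed.

Lemma frac_indep_le H : frac_indep R H <= (nv H)%:R.
Proof. by have [ne ub] := frac_indep_has_sup H; apply: ge_sup. Qed.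

Lemma frac_indep_ge1 H : (0 < nv H)%N -> 1 <= frac_indep R H.
Proof.
rewrite card_gt0 => /set0Pn[v vH].
apply: le_trans (frac_indep_ge (x := fun i => (i == v)%:R) _).
  by rewrite (bigD1 v) //= eqxx lerDl sumr_ge0 // => i _; rewrite ler0n.
split=> [i _|i j ij]; first by case: (i == v); rewrite ?lexx ?ler01.
have : i != j.
  apply: contraTneq ij => ->; apply/negP => /edgeP[_].
  by rewrite setUid cards1.
have [->|_] := eqVneq i v; last by rewrite add0r; case: (j == v); rewrite ?lexx ?ler01.
by rewrite eq_sym => /negPf ->; rewrite addr0.
Qed.

(** Nearly optimal assignments suffice in the construction of blow-ups, as the error
eps may depend on n and p. *)
Lemma frac_indep_adherent H (eps : R) : 0 < eps ->
  exists2 x, frac_indep_assignment H x & frac_indep R H - eps < \sum_(i in vertices H) x i.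
Proof.
move=> eps0; have [ne ub] := frac_indep_has_sup H.
have [|_ [x Hx ->] lt] := sup_adherent eps0 (E := values H).
  by split=> //; exists (nv H)%:R.
by exists x.
Qed.

End FractionalIndependence.

Lemma card_le_sum_cover (X I : finType) (A : {set X}) (C : pred I) (Ai : I -> {set X}) :
  (forall a, a \in A -> exists2 i, C i & a \in Ai i) ->
  (#|A| <= \sum_(i | C i) #|Ai i|)%N.
Proof.
move=> cov; rewrite -sum1_card.
apply: (@leq_trans (\sum_(a in A) \sum_(i | C i) (a \in Ai i))%N).
  apply: leq_sum => a /cov[i Ci ai]; rewrite (bigD1 i) //= ai; exact: leq_addr.
rewrite exchange_big; apply: leq_sum => i _; rewrite -sum1_card big_mkcond [leqRHS]big_mkcond.
by apply: leq_sum => a _; case: (a \in A); case: (a \in Ai i).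
Qed.

Section CountInside.
Variables (R : realType) (T : finType) (W : {set T}) (G : graph T) (n : nat) (d : 'I_n).
Hypothesis WG : rooted W G.
Implicit Types (J : {set {set T}}) (F : {set {set 'I_n}}).

Lemma span_is_graph J : J \subset edges G -> is_graph (cover J, J).
Proof.
move=> sJ; apply/forall_inP => e eJ /=; have [_ ->] := edgeP (subsetP sJ e eJ).
by rewrite (bigcup_max e).
Qed.

(** Isolated vertices are left out, so that every vertex of the span is confined
to the O(#|F|) endpoints of F when J is mapped into F. *)
Definition span J : graph T := insubd G (cover J, J).

Lemma spanE J : J \subset edges G -> vertices (span J) = cover J /\ edges (span J) = J.
Proof. by move=> sJ; rewrite /vertices /edges /span val_insubd span_is_graph. Qed.

Lemma span_subgraph J : J \subset edges G -> subgraph (span J) G.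
Proof.
move=> sJ; rewrite /subgraph; have [-> ->] := spanE sJ; rewrite sJ andbT.
by apply/bigcupsP => e /(subsetP sJ)/edgeP[].
Qed.

Lemma adj_sym (H : graph T) : symmetric (adj H).
Proof. by move=> x y; rewrite /adj setUC. Qed.

Lemma adj_neq (H : graph T) x y : adj H x y -> x != y.
Proof. by move/edgeP=> [_]; rewrite cards2; case: eqP. Qed.

Lemma edge_other (H : graph T) (e : {set T}) x : e \in edges H -> x \in e ->
  exists2 y, e = [set x; y] & x != y.
Proof.
case/edgeP=> _ /eqP/cards2P[a [b [ab ->]]]; rewrite !inE => /orP[]/eqP ->.
  by exists b.
by exists a; rewrite ?(eq_sym b) // setUC.
Qed.

Definition embs_in J F : {set {ffun T -> 'I_n}} :=
  [set f in embs W G d | edge_image f J \subset F].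

(** The maps are sorted by the set B of vertices sent to vertices of large degree;
there are at most 2 ^ #|T| classes, and ntraces_bound_split gives each of them a
half-integral assignment whose weight is the exponent. *)
Lemma ntraces_embs_in J F : J \subset edges G -> J != set0 ->
  (ntraces (embs_in J F) (cover J :\: W))%:R <=
    4 ^+ #|T| * #|F|%:R `^ frac_indep R (del (span J) W).
Proof.
move=> sJ J0; set U := cover J :\: W; set H := del (span J) W.
have [VH EH] : vertices H = U /\ edges H = [set e in J | [disjoint e & W]].
  have [sV sE] := spanE sJ; split; first by rewrite /U -sV.
  transitivity [set e in edges (span J) | [disjoint e & W]]; first by [].
  by rewrite sE.
set al := frac_indep R H.
have al0 : 0 <= al.
  apply: le_trans (frac_indep_ge (x := fun=> 0) _); first by rewrite big1.
  by split=> [i _|i j _]; rewrite ?addr0 ?lexx ler01.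
have [F0|F0] := posnP #|F|.
  suff -> : embs_in J F = set0.
    by rewrite /ntraces imset0 cards0 mulr_ge0 ?exprn_ge0 ?powR_ge0.
  have [e eJ] := set0Pn _ J0.
  apply/setP => f; rewrite in_set in_set0; apply/negP => /andP[_ /subsetP sF].
  have := sF (f @: e); rewrite (cards0_eq F0) in_set0 => /(_ (imset_f _ eJ)).
  by [].
have [s s_lo s_hi] : exists2 s, (s ^ 2 <= #|F|)%N & (#|F| < s.+1 ^ 2)%N.
  exists (\max_(s < #|F|.+1 | (s ^ 2 <= #|F|)%N) s).
    by apply: (big_ind (fun s => (s ^ 2 <= #|F|)%N)) => // x y; case: (leqP x y) => xy;
      rewrite ?(maxn_idPr xy) ?(maxn_idPl (ltnW xy)).
  rewrite ltnNge; apply/negP => le.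
  set m := \max_(s < _ | _) s in le.
  have mF : (m.+1 < #|F|.+1)%N by nia.
  have := @leq_bigmax_cond _ (fun i : 'I_#|F|.+1 => (i ^ 2 <= #|F|)%N)
    (fun i : 'I_#|F|.+1 => i : nat) (Ordinal mF) le.
  by rewrite -/m ltnn.
pose cls (B : {set T}) : {set {ffun T -> 'I_n}} := [set f in embs_in J F | [set x in U | (s < degree F (f x))%N] == B].
have cover_cls : (ntraces (embs_in J F) U <= \sum_(B : {set T} | B \subset U) ntraces (cls B) U)%N.
  apply: card_le_sum_cover => _ /imsetP[f fE ->].
  exists [set x in U | (s < degree F (f x))%N].
    by apply/subsetP => x; rewrite inE => /andP[].
  by apply: imset_f; rewrite inE fE eqxx.
have cls_bound (B : {set T}) : B \subset U ->
    (ntraces (cls B) U)%:R <= 2 ^+ #|T| * #|F|%:R `^ al.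
  move=> sBU.
  have clsP f : f \in cls B -> edge_image f J \subset F /\
      [set x in U | (s < degree F (f x))%N] = B.
    by rewrite !in_set => /andP[/andP[_ ?] /eqP].
  have inF f e : f \in cls B -> e \in J -> f @: e \in F.
    by move=> /clsP[/subsetP sF _] eJ; apply: sF; apply: imset_f.
  have im2 (f : {ffun T -> 'I_n}) x y : f @: [set x; y] = [set f x; f y].
    by rewrite imsetU1 imset_set1.
  have [|f x y fB xU yU|f x fB||||f x fB xU||I [N [sI sN dIN IN bound]]] :=
      @ntraces_bound_split _ _ (cls B) F (adj H) U B s.
  - exact: adj_sym.
  - by rewrite /adj EH inE -im2 => /andP[xyJ _]; apply: inF.
  - rewrite inE => /andP[_ /bigcupP[e eJ xe]].
    have eG := subsetP sJ e eJ; have [y exy _] := edge_other eG xe.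
    by exists (f y); rewrite -im2 -exy; apply: inF.
  - exact: sBU.
  - exact: s_lo.
  - exact: s_hi.
  - by have [_ <-] := clsP f fB; rewrite inE xU.
  - exact: adj_neq.
  (* I is independent and its neighbours lie in N, so x is admissible. *)
  pose x i : R := if i \in I then 1 else if i \in N then 0 else 2^-1.
  have half : (2^-1 + 2^-1 : R) = 1 by field.
  have Hx : frac_indep_assignment H x.
    split=> [i _|i j ij]; rewrite /x.
      by do 2?[case: ifP => _]; rewrite ?lexx ?ler01 //; lra.
    have [iU jU] : i \in U /\ j \in U.
      have [/subsetP sV _] := edgeP ij.
      by rewrite -VH; split; apply: sV; rewrite !inE eqxx ?orbT.
    case: ifPn => iI.
      by rewrite ifN ?(IN i j iI jU ij) ?addr0 // (disjointFl dIN) // (IN i j).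
    case: (boolP (j \in I)) => jI.
      by rewrite (IN j i jI iU) ?add0r // adj_sym.
    by do 2?[case: ifP => _]; lra.
  have sumx : \sum_(i in vertices H) x i = (#|U| + #|I| - #|N|)%:R / 2.
    have xE i : x i = 2^-1 + (i \in I)%:R / 2 - (i \in N)%:R / 2.
      rewrite /x; case: (boolP (i \in I)) => iI.
        by rewrite (disjointFr dIN iI) mul0r subr0 mul1r half.
      by case: (i \in N); rewrite mul0r ?mul0r addr0 ?subr0 // mul1r subrr.
    rewrite VH (eq_bigr _ (fun i _ => xE i)) sumrB big_split /= -!mulr_suml sumr_const.
    have cardin (A : {set T}) : A \subset U -> \sum_(i in U) (i \in A)%:R = #|A|%:R :> R.
      move=> sA; rewrite -sum1_card natr_sum [RHS]big_mkcond [LHS]big_mkcond /=.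
      apply: eq_bigr => i _; case: (boolP (i \in A)) => iA; last by rewrite if_same.
      by rewrite (subsetP sA).
    rewrite !cardin // natrB ?natrD; last by rewrite (leq_trans (subset_leq_card sN)) ?leq_addr.
    by rewrite -mulr_natr; field.
  have le2al : (#|U| + #|I| - #|N|)%:R <= al * 2.
    by rewrite -ler_pdivrMr // -sumx; apply: frac_indep_ge.
  rewrite -(@ler_pXn2r _ 2) ?nnegrE ?mulr_ge0 ?exprn_ge0 ?powR_ge0 //.
  rewrite -[leLHS]natrX; apply: (@le_trans _ _ ((4 ^ #|U| * #|F| ^ (#|U| + #|I| - #|N|))%N%:R)).
    by rewrite ler_nat.
  rewrite natrM exprMn !natrX; apply: ler_pM; rewrite ?exprn_ge0 //.
    rewrite -exprM mulnC exprM (_ : 2 ^+ 2 = 4) ?ler_weXn2l ?max_card ?ler1n //.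
    by rewrite -natrX.
  rewrite -powR_mulrn // -[leRHS]powR_mulrn ?powR_ge0 // -powRrM.
  by rewrite ler_powR // ler1n.
apply: (@le_trans _ _ (\sum_(B : {set T} | B \subset U) (ntraces (cls B) U)%:R)).
  by rewrite -natr_sum ler_nat.
apply: (@le_trans _ _ (\sum_(B : {set T} | B \subset U) 2 ^+ #|T| * #|F|%:R `^ al)).
  exact: ler_sum.
rewrite sumr_const -[leLHS]mulr_natl mulrA ler_wpM2r ?powR_ge0 //.
rewrite (_ : 4 = 2 * 2 :> R); last by rewrite -natrM.
rewrite exprMn ler_wpM2r ?exprn_ge0 //.
rewrite -natrX ler_nat.
apply: (@leq_trans #|powerset U|).
  by apply/subset_leq_card/subsetP => B; rewrite powersetE.
by rewrite card_powerset leq_pexp2l ?max_card.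
Qed.

Lemma card_embs_in J F : (#|W| <= n)%N -> J \subset edges G -> J != set0 ->
  #|embs_in J F|%:R <= (#|W| ^ #|W|)%:R * 4 ^+ #|T| *
    (n ^ (nv G - #|W| - nv (del (span J) W)))%:R *
    #|F|%:R `^ frac_indep R (del (span J) W).
Proof.
move=> Wn sJ J0; have nvU : nv (del (span J) W) = #|cover J :\: W|.
  by rewrite /nv /vertices /=; have [<- _] := spanE sJ.
have sE : embs_in J F \subset embs W G d by apply/subsetP => f /setIdP[].
have sU : cover J :\: W \subset vertices G :\: W.
  by apply: setSD; have /andP[] := span_subgraph sJ; have [-> _] := spanE sJ.
have := card_embs_trace WG sE sU Wn; rewrite -nvU.
set m := (n ^ _)%N => le.
apply: (@le_trans _ _ ((#|W| ^ #|W| * m * ntraces (embs_in J F) (cover J :\: W))%N%:R)).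
  by rewrite ler_nat.
rewrite !natrM [leRHS](_ : _ = (#|W| ^ #|W|)%:R * m%:R *
   (4 ^+ #|T| * #|F|%:R `^ frac_indep R (del (span J) W))); last by ring.
by rewrite ler_wpM2l ?mulr_ge0 // ntraces_embs_in.
Qed.

End CountInside.

(** * Embeddings into disjoint blocks *)

Lemma interval_index_eq w s k i j : (w + i * s <= k < w + i * s + s)%N ->
  (w + j * s <= k < w + j * s + s)%N -> i = j.
Proof.
move=> /andP[i1 i2] /andP[j1 j2].
case: (ltngtP i j) => // lt; have := leq_mul lt (leqnn s); rewrite mulSn; lia.
Qed.

Lemma card_ord_interval (n lo b : nat) : (lo + b <= n)%N ->
  #|[set i : 'I_n | (lo <= i < lo + b)%N]| = b.
Proof.
move=> le; rewrite -[RHS]card_ord.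
rewrite -(card_imset 'I_b (f := fun j => widen_ord le (rshift lo j))); last first.
  by move=> i j /(congr1 val) /= /addnI/val_inj.
apply: eq_card => i; rewrite inE; apply/idP/imsetP => [/andP[loi ib]|[j _ ->]].
  have lt : (i - lo < b)%N by rewrite ltn_subLR.
  by exists (Ordinal lt) => //; apply: val_inj; rewrite /= subnKC.
by rewrite /= leq_addr ltn_add2l ltn_ord.
Qed.

Lemma card_roots (T : finType) (W : {set T}) n : (#|W| <= n)%N -> #|roots W n| = #|W|.
Proof. exact: (@card_ord_interval n 0 #|W|). Qed.

Lemma card_family_prod (A B : finType) (F : A -> {set B}) :
  #|family F| = (\prod_x #|F x|)%N.
Proof.
by rewrite card_family foldrE big_map big_enum.
Qed.

Section Blocks.
Variables (T : finType) (W : {set T}) (G : graph T) (n : nat) (d : 'I_n).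
Hypotheses (WG : rooted W G) (ltWV : (#|W| < nv G)%N) (leVn : (nv G <= n)%N).

Definition block_size : nat := ((n - #|W|) %/ (nv G - #|W|))%N.

(** Disjoint intervals of [n], one for each vertex of G: single roots for the
roots of G, and the first b x elements of consecutive intervals of length
block_size outside of the roots. *)
Definition block (b : T -> nat) (x : T) : {set 'I_n} :=
  let start := (#|W| + index x (enum (vertices G :\: W)) * block_size)%N in
  if x \in W then [set i : 'I_n | i == index x (enum W) :> nat]
  else if x \in vertices G then [set i : 'I_n | (start <= i < start + b x)%N]
  else [set d].

Variable b : T -> nat.
Hypothesis b_le : forall x, x \in vertices G :\: W -> (b x <= block_size)%N.

Let cardVW : #|vertices G :\: W| = (nv G - #|W|)%N.
Proof. by rewrite cardsDS //; case: WG. Qed.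

Lemma block_end x : x \in vertices G :\: W ->
  (#|W| + index x (enum (vertices G :\: W)) * block_size + block_size <= n)%N.
Proof.
move=> xV; set j := index _ _.
have lej : (j < nv G - #|W|)%N by rewrite -cardVW cardE index_mem mem_enum.
have : (block_size * (nv G - #|W|) <= n - #|W|)%N by rewrite leq_divM.
have : ((j.+1) * block_size <= (nv G - #|W|) * block_size)%N by rewrite leq_mul2r lej orbT.
rewrite mulSn mulnC; have := leq_trans (ltnW ltWV) leVn; lia.
Qed.

Lemma card_block x : #|block b x| = if x \in vertices G :\: W then b x else 1%N.
Proof.
rewrite /block inE; case: ifPn => xW /=.
  have ltx : (index x (enum W) < n)%N.
    apply: leq_trans leVn; apply: leq_trans (ltnW ltWV).
    by rewrite cardE index_mem mem_enum.
  rewrite (_ : [set i : 'I_n | _] = [set Ordinal ltx]) ?cards1 //.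
  by apply/setP => i; rewrite !inE.
case: ifPn => xV; last by rewrite cards1.
have xVW : x \in vertices G :\: W by rewrite inE xW.
rewrite card_ord_interval //; apply: leq_trans (block_end xVW).
by rewrite leq_add2l b_le.
Qed.

Lemma card_family_block :
  #|family (block b)| = (\prod_(x in vertices G :\: W) b x)%N.
Proof.
rewrite card_family_prod [RHS]big_mkcond; apply: eq_bigr => x _; exact: card_block.
Qed.

Lemma family_block_embs f : f \in family (block b) -> f \in embs W G d.
Proof.
move=> /familyP ff.
have fW x : x \in W -> f x = index x (enum W) :> nat.
  by move=> xW; have := ff x; rewrite /block xW inE => /eqP.
have fV x : x \in vertices G -> x \notin W ->
    (#|W| + index x (enum (vertices G :\: W)) * block_size <= f x <
    #|W| + index x (enum (vertices G :\: W)) * block_size + block_size)%N.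
  move=> xV xW; have := ff x; rewrite /block (negPf xW) xV inE => /andP[-> /=].
  by move/leq_trans; apply; rewrite leq_add2l b_le // inE xW.
have [WV _] := WG.
rewrite inE; apply/and3P; split.
- apply/dinjectiveP => x y xV yV fxy.
  have Wlt z : z \in W -> (f z < #|W|)%N.
    by move=> zW; rewrite fW // cardE index_mem mem_enum.
  have [xW|xW] := boolP (x \in W); have [yW|yW] := boolP (y \in W).
  + have : index x (enum W) = index y (enum W) by rewrite -!fW // fxy.
    have [xi yi] : x \in enum W /\ y \in enum W by rewrite !mem_enum.
    by move=> eqi; rewrite -(nth_index x xi) -(nth_index x yi) eqi.
  + have /andP[/(leq_trans (leq_addr _ _)) leW _] := fV y yV yW.
    by have := Wlt x xW; rewrite fxy ltnNge leW.
  + have /andP[/(leq_trans (leq_addr _ _)) leW _] := fV x xV xW.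
    by have := Wlt y yW; rewrite -fxy ltnNge leW.
  + have eqi : index x (enum (vertices G :\: W)) = index y (enum (vertices G :\: W)).
      by apply: interval_index_eq (fV x xV xW) _; rewrite fxy; apply: fV.
    have xi : x \in enum (vertices G :\: W) by rewrite mem_enum inE xW.
    have yi : y \in enum (vertices G :\: W) by rewrite mem_enum inE yW.
    by rewrite -(nth_index x xi) -(nth_index x yi) eqi.
- rewrite eqEcard; apply/andP; split.
    by apply/subsetP => _ /imsetP[x xW ->]; rewrite inE fW // cardE index_mem mem_enum.
  rewrite card_roots ?card_in_imset //; last exact: leq_trans (ltnW ltWV) leVn.
  move=> x y xW yW fxy; have [xi yi] : x \in enum W /\ y \in enum W by rewrite !mem_enum.
  by rewrite -(nth_index x xi) -(nth_index x yi) -!fW // fxy.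
- apply/forallP => x; apply/implyP => xV; have := ff x; rewrite /block (negPf xV).
  by rewrite ifN ?inE //; apply: contra xV => /(subsetP WV).
Qed.

End Blocks.

(** * The parameters M and m *)

Lemma le_divn_mul2 n v r : (r < v)%N -> (v <= n)%N ->
  (n <= 2 * v * ((n - r) %/ (v - r)))%N.
Proof.
move=> rv vn; set a := (_ %/ _)%N.
have a1 : (0 < a)%N by rewrite divn_gt0; lia.
have : (n - r < a.+1 * (v - r))%N by apply: ltn_ceil; rewrite subn_gt0.
nia.
Qed.

Section RootedGraph.
Variables (R : realType) (T : finType) (W : {set T}) (G : graph T).
Hypotheses (WG : rooted W G) (eW_gt0 : (0 < ne_root W G)%N).
Implicit Types (H : graph T) (J : {set {set T}}) (p : R).

Lemma subgraphxx : subgraph G G. Proof. by rewrite /subgraph !subxx. Qed.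

Lemma ne_rootE : ne_root W G = #|[set e in edges G | ~~ [disjoint e & W]]|.
Proof.
rewrite /ne_root /ne -(cardsID [set e : {set T} | [disjoint e & W]] (edges G)).
have -> : edges (del G W) = edges G :&: [set e : {set T} | [disjoint e & W]].
  by apply/setP => e; rewrite !inE.
by rewrite addKn; apply: eq_card => e; rewrite !inE andbC.
Qed.

Lemma ne_rootD : ne G = (ne_root W G + ne (del G W))%N.
Proof.
rewrite /ne_root subnK //; apply/subset_leq_card/subsetP => e.
by rewrite inE => /andP[].
Qed.

Lemma ne_gt0 : (0 < ne G)%N. Proof. by rewrite ne_rootD ltn_addr. Qed.

(** Since the roots are independent, every edge has an endpoint outside W. *)
Lemma edge_nonroot (e : {set T}) : e \in edges G -> exists2 x, x \in e & x \notin W.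
Proof.
move=> eG; have [_ /eqP/cards2P[x [y [xy eE]]]] := edgeP eG.
have [xW|xW] := boolP (x \in W); last by exists x; rewrite // eE !inE eqxx.
have [yW|yW] := boolP (y \in W); last by exists y; rewrite // eE !inE eqxx orbT.
by have [_ /(_ x y xW yW)/negP[]] := WG; rewrite /adj -eE.
Qed.

Lemma nv_del_gt0 H : subgraph H G -> (0 < ne H)%N -> (0 < nv (del H W))%N.
Proof.
case/andP=> _ /subsetP sE; rewrite card_gt0 => /set0Pn[e eH].
have [x xe xW] := edge_nonroot (sE e eH); have [/subsetP sV _] := edgeP eH.
by rewrite card_gt0; apply/set0Pn; exists x; rewrite inE xW sV.
Qed.

Lemma card_roots_lt : (#|W| < nv G)%N.
Proof.
have := nv_del_gt0 subgraphxx ne_gt0.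
by rewrite /nv cardsDS ?subn_gt0 //; case: WG.
Qed.

Lemma frac_indep_del_ge1 H : subgraph H G -> (0 < ne H)%N ->
  1 <= frac_indep R (del H W).
Proof. by move=> sH eH; apply: frac_indep_ge1; apply: nv_del_gt0. Qed.

Lemma ne_le H : subgraph H G -> (ne H <= ne G)%N.
Proof. by case/andP=> _; apply: subset_leq_card. Qed.

Lemma span_valid J : J \subset edges G -> J != set0 ->
  subgraph (span G J) G && (0 < ne (span G J))%N.
Proof.
move=> sJ J0; rewrite span_subgraph //=.
by rewrite /ne; have [_ ->] := spanE sJ; rewrite card_gt0.
Qed.

Lemma exists_root_edge : exists2 e, e \in edges G & #|e :\: W| = 1%N.
Proof.
have : (0 < #|[set e in edges G | ~~ [disjoint e & W]]|)%N by rewrite -ne_rootE.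
rewrite card_gt0 => /set0Pn[e]; rewrite inE => /andP[eG eW]; exists e => //.
have [x xe xW] := edge_nonroot eG; have [_ e2] := edgeP eG.
apply/eqP; rewrite eqn_leq; apply/andP; split; last first.
  by rewrite card_gt0; apply/set0Pn; exists x; rewrite inE xW.
rewrite cardsD e2 leq_subLR addn1 ltnS card_gt0.
by move: eW; rewrite -setI_eq0.
Qed.

Section MParam.
Variables (n : nat) (p : R).
Hypotheses (n_gt0 : (0 < n)%N) (p_gt0 : 0 < p).
Let M := M_param W G n p.

Lemma Psi_gt0 H : 0 < Psi W H n p.
Proof. by rewrite mulr_gt0 ?exprn_gt0 ?ltr0n. Qed.

Lemma M_param_attained : exists H, [/\ subgraph H G, (0 < ne H)%N &
  M = Psi W H n p `^ (frac_indep R (del H W))^-1].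
Proof.
rewrite /M /M_param /=.
apply: (big_ind (fun s => exists H, [/\ subgraph H G, (0 < ne H)%N & s = _])).
- by exists G; rewrite subgraphxx ne_gt0.
- by move=> x y Hx Hy; case: (leP x y).
- by move=> H /andP[sH eH]; exists H.
Qed.

Lemma M_param_gt0 : 0 < M.
Proof. by have [H [_ _ ->]] := M_param_attained; rewrite powR_gt0 ?Psi_gt0. Qed.

Lemma M_param_powR_le H : subgraph H G -> (0 < ne H)%N ->
  M `^ frac_indep R (del H W) <= Psi W H n p.
Proof.
move=> sH eH; have al1 := frac_indep_del_ge1 sH eH.
have al0 : 0 < frac_indep R (del H W) by apply: lt_le_trans al1.
have le : M <= Psi W H n p `^ (frac_indep R (del H W))^-1.
  by apply: (@bigmin_le_cond _ _ _ _ H) => //; rewrite sH eH.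
rewrite -[leRHS]powRr1 ?(ltW (Psi_gt0 _)) // -(mulVf (lt0r_neq0 al0)) powRrM.
by apply: ge0_ler_powR; rewrite ?nnegrE ?(ltW al0) ?(ltW M_param_gt0) ?powR_ge0.
Qed.

(** The subgraph consisting of a single edge at a root has Psi = n p and, without
its root, fractional independence number 1. *)
Lemma M_param_le : M <= n%:R * p.
Proof.
have [e eG e1] := exists_root_edge.
have sJ : [set e] \subset edges G by rewrite sub1set.
have J0 : [set e] != set0 by rewrite -card_gt0 cards1.
have /andP[sH eH] := span_valid sJ J0; have [VH EH] := spanE sJ.
have nv1 : nv (del (span G [set e]) W) = 1%N.
  by rewrite /nv /vertices /= -/(vertices _) VH /cover big_set1.
have al : frac_indep R (del (span G [set e]) W) = 1.
  apply/eqP; rewrite eq_le frac_indep_del_ge1 // andbT.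
  by apply: le_trans (frac_indep_le _ _) _; rewrite nv1.
have := M_param_powR_le sH eH; rewrite al powRr1 ?(ltW M_param_gt0) //.
by rewrite /Psi nv1 /ne EH cards1 !expr1.
Qed.

(** The exponent of n in the minimized quantity is v(H - R) / alpha >= 1, and the
exponent of p is at most e(H), as alpha >= 1. *)
Lemma M_param_ge : p <= 1 -> n%:R * p ^+ ne G <= M.
Proof.
move=> p1; have [H [sH eH ->]] := M_param_attained.
set al := frac_indep R (del H W).
have al1 : 1 <= al := frac_indep_del_ge1 sH eH.
have al0 : 0 < al by apply: lt_le_trans al1.
have n0 : (0 : R) <= n%:R by [].
rewrite /Psi powRM ?exprn_ge0 // ?(ltW p_gt0) //; apply: ler_pM => //.
- by rewrite exprn_ge0 ?(ltW p_gt0).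
- rewrite -powR_mulrn // -powRrM -[leLHS]powRr1 //.
  apply: ler_powR; first by rewrite ler1n.
  by rewrite ler_pdivlMr // mul1r frac_indep_le.
- rewrite -!powR_mulrn ?(ltW p_gt0) // -powRrM.
  apply: ger_powR; first by rewrite p_gt0.
  rewrite ler_pdivrMr //; apply: (@le_trans _ _ (ne G)%:R); first by rewrite ler_nat ne_le.
  by rewrite ler_peMr.
Qed.

Lemma m_param_attained : exists H, [/\ subgraph H G, (0 < ne H)%N &
  m_param R W G = (ne H)%:R / (nv (del H W))%:R].
Proof.
have [H [sH eH] ->] : exists2 H, subgraph H G /\ (0 < ne H)%N &
    m_param R W G = (ne H)%:R / (nv (del H W))%:R.
  have PG : (subgraph G G && (0 < ne G)%N) by rewrite subgraphxx ne_gt0.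
  rewrite /m_param.
  have [|H /andP[sH eH] ->] := @eq_bigmax _ _ _ (0 : R) G
    (fun H => subgraph H G && (0 < ne H)%N) (fun H => (ne H)%:R / (nv (del H W))%:R) PG.
    by move=> H _; rewrite divr_ge0.
  by exists H.
by exists H.
Qed.

Lemma m_param_gt0 : 0 < m_param R W G.
Proof.
have [H [sH eH ->]] := m_param_attained.
by rewrite divr_gt0 ?ltr0n ?nv_del_gt0.
Qed.

Let thr : R := n%:R `^ (- (m_param R W G)^-1).

(** The threshold n ^ (- 1 / m) is the point where Psi of a subgraph that attains m
crosses 1. *)
Lemma Psi_root_threshold H : subgraph H G -> (0 < ne H)%N ->
  (ne H)%:R = m_param R W G * (nv (del H W))%:R -> p <= thr -> Psi W H n p <= 1.
Proof.
move=> sH eH mE; rewrite /thr => pt.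
have : p ^+ ne H <= (n%:R ^+ nv (del H W))^-1.
  rewrite -powR_mulrn ?(ltW p_gt0) // mE -[X in _ <= X^-1]powR_mulrn // -powRN.
  rewrite (_ : - _ = - (m_param R W G)^-1 * (m_param R W G * (nv (del H W))%:R)); last first.
    by rewrite mulNr mulKf // lt0r_neq0 // m_param_gt0.
  rewrite [leRHS]powRrM; apply: ge0_ler_powR; rewrite ?nnegrE ?powR_ge0 ?(ltW p_gt0) //.
  by rewrite mulr_ge0 // ltW // m_param_gt0.
by rewrite /Psi mulrC -ler_pdivlMr ?exprn_gt0 ?ltr0n // div1r.
Qed.

Lemma M_param_ge1 : thr <= p -> 1 <= M.
Proof.
rewrite /thr => tp; have [H [sH eH ->]] := M_param_attained.
have s0 : (0 : R) < (nv (del H W))%:R by rewrite ltr0n nv_del_gt0.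
have m0 := m_param_gt0.
have le_m : (ne H)%:R <= m_param R W G * (nv (del H W))%:R.
  rewrite -ler_pdivrMr //.
  by apply: (@le_bigmax_cond _ _ _ (0 : R) H _ (fun H => (ne H)%:R / (nv (del H W))%:R)); rewrite sH eH.
have Psi1 : 1 <= Psi W H n p.
  rewrite /Psi -ler_pdivrMl ?exprn_gt0 ?ltr0n // mulr1.
  rewrite -[X in X^-1]powR_mulrn // -powRN -powR_mulrn ?(ltW p_gt0) //.
  apply: (@le_trans _ _ (thr `^ (ne H)%:R)); last first.
    by apply: ge0_ler_powR; rewrite ?nnegrE ?powR_ge0 ?(ltW p_gt0).
  rewrite /thr -powRrM; apply: ler_powR; first by rewrite ler1n.
  by rewrite mulNr lerN2 mulrC ler_pdivrMr // mulrC.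
rewrite [leLHS](_ : 1 = 1 `^ (frac_indep R (del H W))^-1); last by rewrite powR1.
by apply: ge0_ler_powR; rewrite ?nnegrE ?invr_ge0 ?(le_trans ler01) ?frac_indep_del_ge1.
Qed.

End MParam.

Definition copy_const : nat := ((2 * nv G) ^ nv G * nv G ^ nv G)%N.

Section CopyNumber.
Variables (n : nat).
Hypothesis leVn : (nv G <= n)%N.

Lemma ambient_gt0 : (0 < n)%N.
Proof. exact: leq_trans (leq_ltn_trans (leq0n _) card_roots_lt) leVn. Qed.

Lemma card_roots_le_n : (#|W| <= n)%N.
Proof. exact: leq_trans (ltnW card_roots_lt) leVn. Qed.

Lemma n_le_block_size : (n <= 2 * nv G * block_size W G n)%N.
Proof. exact: le_divn_mul2 card_roots_lt leVn. Qed.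

(** Sending each non-root vertex to its own block of length at least n / (2 v)
gives sufficiently many embeddings. *)
Lemma expn_le_copies : (n ^ (nv G - #|W|) <= copy_const * #|copies W G n|)%N.
Proof.
pose d := Ordinal ambient_gt0.
have [_ emb_le] := card_copies_embs R d WG.
have fam_le : (block_size W G n ^ (nv G - #|W|) <= #|embs W G d|)%N.
  have bb x : x \in vertices G :\: W -> (block_size W G n <= block_size W G n)%N by [].
  have := card_family_block d WG card_roots_lt leVn bb.
  rewrite prod_nat_const cardsDS; last by case: WG.
  move=> <-; apply/subset_leq_card/subsetP => f.
  exact: (family_block_embs WG card_roots_lt leVn bb).
set k := (nv G - #|W|)%N in fam_le *.
apply: (@leq_trans ((2 * nv G * block_size W G n) ^ k)).
  by rewrite leq_exp2r ?subn_gt0 ?card_roots_lt // n_le_block_size.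
rewrite expnMn -mulnA; apply: leq_mul; last exact: leq_trans fam_le emb_le.
have v0 : (0 < nv G)%N by apply: leq_ltn_trans card_roots_lt.
by rewrite leq_pexp2l ?muln_gt0 // leq_subr.
Qed.

End CopyNumber.
End RootedGraph.

(** * Upper bounds by the moment method *)

Lemma prod_pair_weight (R : realType) n (p : R) (A : {set {set 'I_n}}) :
  A \subset pairs n -> \prod_(u in A) pair_weight p u = p ^+ #|A|.
Proof.
move=> /subsetP sA; rewrite (eq_bigr (fun=> p)) ?prodr_const // => u /sA.
by rewrite inE /pair_weight => ->.
Qed.

Lemma edges_pairs n (K : graph 'I_n) : edges K \subset pairs n.
Proof. by apply/subsetP => u /edgeP[_]; rewrite inE => ->. Qed.

Section UpperTail.
Variables (R : realType) (T : finType) (W : {set T}) (G : graph T).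
Hypotheses (WG : rooted W G) (eW_gt0 : (0 < ne_root W G)%N).
Variable t : R.
Hypothesis t_gt1 : 1 < t.

(** A copy disjoint from F contributes p ^ e(G). The others are sorted by the
nonempty set J of edges of G that an embedding maps into F. *)
Lemma sum_overlap n (d : 'I_n) (p : R) (F : {set {set 'I_n}}) : 0 < p <= 1 ->
  \sum_(K in copies W G n) \prod_(u in edges K :\: F) pair_weight p u <=
  #|copies W G n|%:R * p ^+ ne G +
  \sum_(J : {set {set T}} | (J \subset edges G) && (J != set0))
     #|embs_in W G d J F|%:R * p ^+ (ne G - #|J|).
Proof.
move=> /andP[p0 p1].
pose g (S : {set {set 'I_n}}) : R :=
  if S :&: F == set0 then 0 else p ^+ (ne G - #|S :&: F|).
have g0 S : 0 <= g S by rewrite /g; case: ifP => // _; rewrite exprn_ge0 ?ltW.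
apply: (@le_trans _ _ (\sum_(K in copies W G n) (p ^+ ne G + g (edges K)))).
  apply: ler_sum => K KC.
  rewrite prod_pair_weight; last first.
    by apply: subset_trans (edges_pairs K); apply: subsetDl.
  rewrite cardsD -/(ne K) (ne_copy KC) /g; case: eqP => [->|_].
    by rewrite cards0 subn0 addr0.
  by rewrite lerDr exprn_ge0 ?ltW.
rewrite big_split /= sumr_const -[X in X + _]mulr_natl lerD2l.
have [le _] := sum_embs_copies d WG g0; apply: le_trans le _.
have im (J : {set {set T}}) : #|embs_in W G d J F|%:R =
    \sum_(f in embs W G d) (edge_image f J \subset F)%:R :> R.
  rewrite -sum1_card natr_sum big_mkcond [RHS]big_mkcond; apply: eq_bigr => f _.
  by rewrite in_set; case: (f \in _) => //=; case: ifP.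
under [leRHS]eq_bigr do rewrite im mulr_suml.
rewrite exchange_big /=; apply: ler_sum => f fE.
have [f_inj _ _] := embsP fE.
pose J := [set e in edges G | f @: (e : {set T}) \in F].
have sJ : J \subset edges G by apply/subsetP => e /setIdP[].
have imJ : edge_image f (edges G) :&: F = edge_image f J.
  apply/setP => u; rewrite inE; apply/andP/imsetP => [[/imsetP[e eG ->] uF]|[e]].
    by exists e; rewrite // inE eG.
  by rewrite inE => /andP[eG eF] ->; split=> //; apply: imset_f.
have cardJ : #|edge_image f J| = #|J|.
  apply: card_in_imset => e e' /(subsetP sJ) eG /(subsetP sJ) eG'.
  exact: (imset_edges_inj f_inj).
have sum0 (C : pred {set {set T}}) :
    0 <= \sum_(J' | C J') (edge_image f J' \subset F)%:R * p ^+ (ne G - #|J'|).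
  by apply: sumr_ge0 => J' _; rewrite mulr_ge0 // exprn_ge0 ?ltW.
rewrite /g imJ cardJ; case: ifPn => [_|J0]; first exact: sum0.
have J0' : J != set0 by apply: contra J0 => /eqP ->; rewrite /edge_image imset0.
rewrite (bigD1 J) /= ?sJ // -imJ subsetIr mul1r lerDl; exact: sum0.
Qed.

Definition emb_const : R := (#|W| ^ #|W|)%:R * 4 ^+ #|T|.

Lemma emb_const_ge0 : 0 <= emb_const.
Proof. by rewrite mulr_ge0 ?exprn_ge0. Qed.

Lemma expn_le_copiesR n : (nv G <= n)%N ->
  (n ^ (nv G - #|W|))%:R <= (copy_const G)%:R * #|copies W G n|%:R :> R.
Proof. by move=> leVn; rewrite -natrM ler_nat expn_le_copies. Qed.

Lemma copies_gt0 n : (nv G <= n)%N -> (0 < #|copies W G n|)%N.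
Proof.
move=> leVn; have le := expn_le_copies R WG eW_gt0 leVn.
have : (0 < n ^ (nv G - #|W|))%N by rewrite expn_gt0 (ambient_gt0 WG eW_gt0 leVn).
by move/leq_trans=> /(_ _ le); rewrite muln_gt0 => /andP[].
Qed.

Lemma mean_gt0 n (p : R) : (nv G <= n)%N -> 0 < p ->
  0 < t * (#|copies W G n|%:R * p ^+ ne G).
Proof.
move=> leVn p0; rewrite !mulr_gt0 ?exprn_gt0 ?ltr0n ?copies_gt0 //.
exact: lt_trans t_gt1.
Qed.

Lemma nv_del_span_le (J : {set {set T}}) : J \subset edges G ->
  (nv (del (span G J) W) <= nv G - #|W|)%N.
Proof.
move=> sJ; have [WV _] := WG; rewrite -cardsDS //.
apply/subset_leq_card/setSD.
by have /andP[] := span_subgraph sJ.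
Qed.

(** By card_embs_in the number of embeddings is of order n ^ (v - r - s) (eta M) ^ a,
where s and a are the order and the fractional independence number of the span
of J without the roots. Here eta ^ a <= eta since a >= 1, and M ^ a is at most
Psi = n ^ s p ^ #|J| by the definition of M. *)
Lemma overlap_term_le n (d : 'I_n) (p eta : R) (F : {set {set 'I_n}})
    (J : {set {set T}}) : (nv G <= n)%N -> 0 < p <= 1 -> 0 <= eta <= 1 ->
  #|F|%:R <= eta * M_param W G n p -> J \subset edges G -> J != set0 ->
  #|embs_in W G d J F|%:R * p ^+ (ne G - #|J|) <=
    emb_const * (copy_const G)%:R * eta * (#|copies W G n|%:R * p ^+ ne G).
Proof.
move=> leVn /andP[p0 p1] /andP[eta0 eta1] leF sJ J0.
have n0 := ambient_gt0 WG eW_gt0 leVn.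
have M0 := M_param_gt0 eW_gt0 n0 p0.
have /andP[sH eH] := span_valid sJ J0.
set H := span G J in sH eH; set al := frac_indep R (del H W).
have al1 : 1 <= al := frac_indep_del_ge1 R WG sH eH.
have al0 : 0 <= al := le_trans ler01 al1.
have F_le : #|F|%:R `^ al <= eta * (n%:R ^+ nv (del H W) * p ^+ #|J|).
  apply: (@le_trans _ _ ((eta * M_param W G n p) `^ al)).
    by apply: ge0_ler_powR; rewrite ?nnegrE // mulr_ge0 // ltW.
  rewrite powRM // ?(ltW M0) //; apply: ler_pM; rewrite ?powR_ge0 //.
    have [->|eta_neq0] := eqVneq eta 0.
      by rewrite powR0 // gt_eqF // (lt_le_trans ltr01).
    by apply: ge1r_powR => //; rewrite lt0r eta_neq0 eta0.
  have := M_param_powR_le WG eW_gt0 n0 p0 sH eH.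
  have neH : ne H = #|J| by rewrite /ne /H (spanE sJ).2.
  by rewrite /Psi neH.
have := card_embs_in R d WG F (card_roots_le_n WG eW_gt0 leVn) sJ J0; rewrite -/H -/al => leE.
have eJ : (#|J| <= ne G)%N by apply: subset_leq_card.
apply: (@le_trans _ _ (emb_const * (n ^ (nv G - #|W| - nv (del H W)))%:R *
   (eta * (n%:R ^+ nv (del H W) * p ^+ #|J|)) * p ^+ (ne G - #|J|))).
  rewrite ler_wpM2r ?exprn_ge0 ?(ltW p0) //; apply: le_trans leE _.
  by rewrite ler_wpM2l // mulr_ge0 ?emb_const_ge0.
rewrite (_ : _ * _ = emb_const * eta * ((n ^ (nv G - #|W|))%:R * p ^+ ne G)); last first.
  rewrite -[in RHS](subnK (nv_del_span_le sJ)) expnD -[in RHS](subnK eJ) exprD.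
  rewrite natrM [X in _ * (_ * X * _)]natrX.
  by move: emb_const (_ ^ _)%:R (_ ^+ _) (_ ^+ _) (_ ^+ _) => x1 x2 x3 x4 x5; ring.
rewrite (_ : emb_const * (copy_const G)%:R * eta * _ = emb_const * eta *
  ((copy_const G)%:R * #|copies W G n|%:R * p ^+ ne G)); last first.
  by move: emb_const (copy_const G)%:R (#|_|%:R) (_ ^+ _) => x1 x2 x3 x4; ring.
rewrite ler_wpM2l ?mulr_ge0 ?emb_const_ge0 //.
by rewrite ler_wpM2r ?exprn_ge0 ?(ltW p0) // expn_le_copiesR.
Qed.

(** The m-th moment is used with m = floor (c0 M) + 1, so that m - 1 copies have
at most eta M edges, where eta is so small that the mean increases at most to
(1 + t) / 2 times itself. As m >= 1, this contains Markov's inequality, which is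
the second bound. *)
Lemma upper_tail_le_exp_M : exists2 c : R, 0 < c &
  forall n (p : R), (nv G <= n)%N -> 0 < p <= 1 ->
    upper_tail W G n p t <= expR (- (c * M_param W G n p)) /\
    upper_tail W G n p t <= expR (- c).
Proof.
pose C := 2 ^+ ne G * (emb_const * (copy_const G)%:R).
have C0 : 0 <= C by rewrite !mulr_ge0 ?exprn_ge0 ?emb_const_ge0.
pose eta : R := Num.min 1 ((t - 1) / (2 * (C + 1))).
have eta0 : 0 < eta.
  by rewrite lt_min ltr01 divr_gt0 ?subr_gt0 // mulr_gt0 // ltr_wpDl.
have eta1 : eta <= 1 by rewrite ge_min lexx.
have Ceta : C * eta <= (t - 1) / 2.
  apply: (@le_trans _ _ (C * ((t - 1) / (2 * (C + 1))))).
    by rewrite ler_wpM2l // ge_min lexx orbT.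
  rewrite (_ : C * _ = C / (C + 1) * ((t - 1) / 2)); last by field; lra.
  rewrite ler_piMl //; first by rewrite divr_ge0 // subr_ge0 ltW.
  by rewrite ler_pdivrMr ?mul1r ?lerDl // ltr_wpDl.
have e0 : (0 : R) < (ne G)%:R by rewrite ltr0n (ne_gt0 eW_gt0).
pose rho := (1 + t) / (2 * t).
have [rho0 rho1] : 0 < rho /\ rho < 1.
  have t0 : 0 < t := lt_trans ltr01 t_gt1.
  split; first by rewrite divr_gt0 ?addr_gt0 ?mulr_gt0.
  rewrite ltr_pdivrMr ?mulr_gt0 // mul1r; move: t_gt1; lra.
have lnrho : ln rho < 0 by apply: ln_lt0; rewrite rho0.
pose c0 := eta / (ne G)%:R.
have c00 : 0 < c0 by rewrite divr_gt0.
exists (Num.min (- ln rho) (c0 * - ln rho)).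
  by rewrite lt_min oppr_gt0 lnrho mulr_gt0 // oppr_gt0.
move=> n p leVn p01; have /andP[p0 p1] := p01.
have n0 := ambient_gt0 WG eW_gt0 leVn; pose d := Ordinal n0.
have M0 := M_param_gt0 eW_gt0 n0 p0; set M := M_param W G n p in M0 *.
pose m := (Num.truncn (c0 * M)).+1.
have mlt : c0 * M < m%:R by apply: truncnS_gt.
have mle : (m.-1)%:R <= c0 * M by rewrite /m /= truncn_le mulr_ge0 ?ltW.
have q01 := pair_weight01 (n := n) (p := p) (introT andP (conj (ltW p0) p1)).
have tail : upper_tail W G n p t <= rho ^+ m.
  rewrite upper_tailE.
  have l0 := mean_gt0 leVn p0.
  set mn := #|copies W G n|%:R * p ^+ ne G in l0 *.
  have mn0 : 0 < mn by rewrite mulr_gt0 ?exprn_gt0 ?ltr0n ?copies_gt0.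
  have -> : rho = ((1 + t) / 2 * mn) / (t * mn).
    by rewrite /rho; field; rewrite !gt_eqF // (lt_trans ltr01 t_gt1).
  apply: (ncontained_tail (d := ne G) q01) => //; first by move=> K /ne_copy <-.
  move=> F leF; apply: le_trans (sum_overlap d F p01) _.
  have leF' : #|F|%:R <= eta * M.
    apply: (@le_trans _ _ ((m.-1 * ne G)%N%:R)); first by rewrite ler_nat.
    rewrite natrM (_ : eta * M = c0 * M * (ne G)%:R); first by rewrite ler_wpM2r.
    by rewrite /c0; field; rewrite gt_eqF.
  apply: (@le_trans _ _ (mn + \sum_(J : {set {set T}} | (J \subset edges G) && (J != set0))
      emb_const * (copy_const G)%:R * eta * mn)).
    rewrite lerD2l; apply: ler_sum => J /andP[sJ J0].
    by apply: overlap_term_le; rewrite // eta1 ltW.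
  rewrite sumr_const.
  have leJ : (#|[pred J : {set {set T}} | (J \subset edges G) && (J != set0)]|
      <= 2 ^ ne G)%N.
    rewrite -card_powerset; apply/subset_leq_card/subsetP => J.
    by rewrite !inE => /andP[].
  apply: (@le_trans _ _ (mn + C * eta * mn)); last first.
    rewrite -[X in X + _]mul1r -mulrDl ler_wpM2r ?(ltW mn0) //.
    by move: Ceta; move: (C * eta) => z; lra.
  rewrite lerD2l -[leLHS]mulr_natl /C -natrX -!mulrA ler_wpM2r ?ler_nat //.
  by rewrite !mulr_ge0 ?exprn_ge0 ?(ltW eta0) ?(ltW p0).
split; apply: le_trans tail _.
  rewrite -[rho in leLHS]lnK ?posrE // -expRM_natl ler_expR.
  apply: (@le_trans _ _ (- (c0 * - ln rho * M))); last first.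
    by rewrite lerN2 ler_wpM2r ?(ltW M0) // ge_min lexx orbT.
  by rewrite mulrN mulNr opprK mulrAC ler_wnM2r ?ltW.
rewrite -[rho in leLHS]lnK ?posrE // -expRM_natl ler_expR.
apply: (@le_trans _ _ (ln rho)); last by rewrite lerNr ge_min lexx.
by rewrite ger_nMl // ler1n.
Qed.

End UpperTail.

Lemma half_ratio_le (R : realFieldType) (z : R) : 0 <= z <= 1 ->
  1 + z / 2 <= (1 + - (z / 4)) * (1 + z).
Proof.
move=> /andP[z0 z1]; have : 0 <= z * (1 - z) by rewrite mulr_ge0 // subr_ge0.
by lra.
Qed.

Section RootPairs.
Variables (T : finType) (W : {set T}) (G : graph T) (n : nat).
Hypothesis WG : rooted W G.

Definition root_pairs : {set {set 'I_n}} :=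
  [set u in pairs n | ~~ [disjoint u & roots W n]].

Lemma card_copy_nonroot K : K \in copies W G n ->
  #|edges K :\: root_pairs| = ne (del G W).
Proof.
move=> KC; have [f [f_inj _ fE fW]] := copiesP KC.
have [WV _] := WG.
have disE (e : {set T}) : e \in edges G ->
    [disjoint f @: e & roots W n] = [disjoint e & W].
  move=> /edgeP[/subsetP eV _]; rewrite -fW -!setI_eq0.
  apply/eqP/eqP => /setP e0; apply/setP => x.
    rewrite in_set0 in_setI; apply/negP => /andP[xe xW].
    by have := e0 (f x); rewrite in_set0 in_setI !imset_f.
  rewrite in_set0 in_setI; apply/negP => /andP[/imsetP[y ye ->] /imsetP[z zW]].
  move=> fyz; have yz : y = z by apply: f_inj => //; [apply: eV | apply: (subsetP WV)].
  by have := e0 y; rewrite in_set0 in_setI ye yz zW.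
have sD : edges (del G W) \subset edges G by apply/subsetP => e /setIdP[].
have -> : edges K :\: root_pairs = [set f @: (e : {set T}) | e in edges (del G W)].
  apply/setP => u; rewrite in_setD -fE; apply/andP/imsetP => [[uR /imsetP[e eG ue]]|[e]].
    exists e => //; rewrite inE eG /= -disE // -ue; move: uR; rewrite in_set negb_and negbK.
    case/orP=> //; rewrite ue inE => /negP[]; apply/eqP.
    by rewrite card_in_imset; have [eV e2] := edgeP eG => // x y xe ye;
      apply: f_inj; apply: (subsetP eV).
  rewrite inE => /andP[eG eW] ->; split; last exact: imset_f.
  by rewrite in_set disE // eW andbF.
rewrite card_in_imset // => e e' /(subsetP sD) eG /(subsetP sD).
exact: (imset_edges_inj f_inj eG).
Qed.

End RootPairs.

Section Concentration.
Variables (R : realType) (T : finType) (W : {set T}) (G : graph T).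
Hypotheses (WG : rooted W G) (eW_gt0 : (0 < ne_root W G)%N).
Variable t : R.
Hypothesis t_gt1 : 1 < t.

Definition root_threshold (k : nat) : R := t `^ (- k%:R^-1).

Lemma root_threshold_gt0 k : 0 < root_threshold k.
Proof. by rewrite powR_gt0 // (lt_trans ltr01). Qed.

Lemma root_thresholdX k : (0 < k)%N -> t * root_threshold k ^+ k = 1.
Proof.
move=> k0; have t0 : 0 < t := lt_trans ltr01 t_gt1.
rewrite -powR_mulrn ?(ltW (root_threshold_gt0 _)) // -powRrM mulNr mulVf ?pnatr_eq0 -?lt0n //.
by rewrite powR_inv1 ?(ltW t0) // mulfV // gt_eqF.
Qed.

Lemma root_threshold_lt1 k : (0 < k)%N -> root_threshold k < 1.
Proof.
move=> k0; rewrite ltNge; apply/negP => le.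
have := root_thresholdX k0; apply/eqP; rewrite gt_eqF //.
apply: (lt_le_trans t_gt1); rewrite ler_peMr ?(ltW (lt_trans ltr01 t_gt1)) //.
by rewrite exprn_ege1.
Qed.

(** The threshold is the density at which planting k edges of each copy multiplies
the mean by t. *)
Lemma le_root_threshold k p : (0 < k)%N -> 0 <= p ->
  (p <= root_threshold k) = (t * p ^+ k <= 1).
Proof.
move=> k0 p0; rewrite -(root_thresholdX k0) ler_pM2l ?(lt_trans ltr01) //.
by rewrite ler_pXn2r ?nnegrE ?(ltW (root_threshold_gt0 _)).
Qed.

(** A single edge outside of the roots fixes two vertices of the copy. *)
Lemma card_embs_edge n (d : 'I_n) (F : {set {set 'I_n}}) e :
  (nv G <= n)%N -> e \in edges (del G W) ->
  #|embs_in W G d [set e] F|%:R * n%:R ^+ 2 <=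
    emb_const R W * (copy_const G)%:R * #|copies W G n|%:R * #|F|%:R.
Proof.
move=> leVn; rewrite inE => /andP[eG eW].
have sJ : [set e] \subset edges G by rewrite sub1set.
have J0 : [set e] != set0 by rewrite -card_gt0 cards1.
have [eV e2] := edgeP eG.
set H := del (span G [set e]) W.
have VH : vertices H = e.
  have [VS _] := spanE sJ.
  transitivity (vertices (span G [set e]) :\: W); first by [].
  by rewrite VS /cover big_set1; apply/setDidPl.
have nvH : nv H = 2%N by rewrite /nv VH.
have /andP[sH eH] := span_valid sJ J0.
have al : frac_indep R H = 1.
  apply/eqP; rewrite eq_le (frac_indep_del_ge1 R WG sH eH) andbT.
  rewrite leNgt; apply/negP => lt.
  have [|x [x01 xE]] := @frac_indep_adherent R _ H (frac_indep R H - 1).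
    by rewrite subr_gt0.
  rewrite opprB addrC subrK VH.
  have /eqP/cards2P[a [b [ab eab]]] := e2.
  rewrite eab big_setU1 ?inE //= big_set1 ltNge xE //.
  rewrite /adj -eab inE eW andbT; have [_ ->] := spanE sJ; exact: set11.
have leV : (2 <= nv G - #|W|)%N by rewrite -nvH; exact: nv_del_span_le.
have := card_embs_in R d WG F (card_roots_le_n WG eW_gt0 leVn) sJ J0.
rewrite -/H al powRr1 // nvH -/(emb_const R W) => le.
apply: (@le_trans _ _ (emb_const R W * (n ^ (nv G - #|W| - 2))%:R * #|F|%:R * n%:R ^+ 2)).
  by rewrite ler_wpM2r ?exprn_ge0.
have -> : emb_const R W * (n ^ (nv G - #|W| - 2))%:R * #|F|%:R * n%:R ^+ 2 =
    emb_const R W * (n ^ (nv G - #|W|))%:R * #|F|%:R.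
  rewrite -[in RHS](subnK leV) expnD natrM [X in _ * (_ * X) * _]natrX.
  by move: (emb_const R W) (_ ^ _)%N%:R (_ ^+ _) (#|F|%:R) => x1 x2 x3 x4; ring.
rewrite ler_wpM2r // -[leRHS]mulrA ler_wpM2l ?emb_const_ge0 //.
exact: expn_le_copiesR.
Qed.

Lemma sum_overlap_nonroot n (d : 'I_n) (p : R) (F : {set {set 'I_n}}) : 0 < p <= 1 ->
  \sum_(K in copies W G n) \prod_(u in (edges K :\: root_pairs W n) :\: F) pair_weight p u <=
  #|copies W G n|%:R * p ^+ ne (del G W) +
  \sum_(e in edges (del G W)) #|embs_in W G d [set e] F|%:R.
Proof.
move=> /andP[p0 p1].
pose g (S : {set {set 'I_n}}) : R := ((S :\: root_pairs W n) :&: F != set0)%:R.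
have g0 S : 0 <= g S by [].
apply: (@le_trans _ _ (\sum_(K in copies W G n) (p ^+ ne (del G W) + g (edges K)))).
  apply: ler_sum => K KC.
  rewrite prod_pair_weight; last first.
    by apply: subset_trans (edges_pairs K); rewrite !subDset; apply: subset_trans (subsetUr _ _) (subsetUr _ _).
  rewrite cardsD (card_copy_nonroot WG KC) /g; case: eqP => [->|_].
    by rewrite cards0 subn0 addr0.
  by rewrite ler_wpDl ?exprn_ge0 ?exprn_ile1 ?(ltW p0).
rewrite big_split /= sumr_const -[X in X + _]mulr_natl lerD2l.
have [le _] := sum_embs_copies d WG g0; apply: le_trans le _.
have im (J : {set {set T}}) : #|embs_in W G d J F|%:R =
    \sum_(f in embs W G d) (edge_image f J \subset F)%:R :> R.
  rewrite -sum1_card natr_sum big_mkcond [RHS]big_mkcond; apply: eq_bigr => f _.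
  by rewrite in_set; case: (f \in _) => //=; case: ifP.
under [leRHS]eq_bigr do rewrite im.
rewrite exchange_big /=; apply: ler_sum => f fE.
have [f_inj fW _] := embsP fE.
rewrite /g; case: eqP => [_|/eqP/set0Pn[u]]; first by apply: sumr_ge0.
rewrite !inE => /andP[/andP[uR /imsetP[e eG ue]] uF].
have eW : e \in edges (del G W).
  rewrite inE eG /=; move: uR; rewrite ue (edge_image_card2 f_inj eG) /= negbK -fW.
  rewrite -!setI_eq0 => /eqP/setP dis; apply/eqP/setP => x.
  rewrite in_set0 in_setI; apply/negP => /andP[xe xW].
  by have := dis (f x); rewrite in_set0 in_setI !imset_f.
rewrite (bigD1 e) //= (_ : _ \subset F) ?lerDl ?sumr_ge0 //.
by rewrite /edge_image imset_set1 sub1set -ue.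
Qed.

(** With all edges at the roots added, the number of copies has the mean
N p ^ e(G - R), which is t mu divided by (p / p1) ^ e_R >= 1 + x, where x = p - p1.
For moments of order m about x n ^ 2 the sets F have O(x n ^ 2) edges, and change
this mean by a factor of at most 1 + x / 2; each further moment then gains a
factor exp(- x / 4). *)
Lemma upper_tail_le_exp_sq : exists2 c : R, 0 < c &
  forall n (p : R), (nv G <= n)%N -> root_threshold (ne_root W G) <= p <= 1 ->
    upper_tail W G n p t <=
      expR (- (c * ((p - root_threshold (ne_root W G)) ^+ 2 * n%:R ^+ 2))).
Proof.
set p1 := root_threshold _.
have p1_gt0 : 0 < p1 := root_threshold_gt0 _.
have p1X : t * p1 ^+ ne_root W G = 1 := root_thresholdX eW_gt0.
have p1_lt1 : p1 < 1 := root_threshold_lt1 eW_gt0.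
have t0 : 0 < t := lt_trans ltr01 t_gt1.
pose e' := ne (del G W).
pose A : R := e'%:R * (emb_const R W * (copy_const G)%:R).
have A0 : 0 <= A by rewrite !mulr_ge0 ?emb_const_ge0.
pose C : R := A * (ne G)%:R / p1 ^+ e' + 1.
have C1 : 1 <= C by rewrite lerDr divr_ge0 ?mulr_ge0 ?exprn_ge0 ?(ltW p1_gt0).
have C0 : 0 < C := lt_le_trans ltr01 C1.
exists (8 * C)^-1; first by rewrite invr_gt0 mulr_gt0.
move=> n p leVn /andP[p1p ple1].
have p0 : 0 < p := lt_le_trans p1_gt0 p1p.
have p01 : 0 < p <= 1 by rewrite p0.
have n0 := ambient_gt0 WG eW_gt0 leVn; pose d := Ordinal n0.
have nR : (0 : R) < n%:R by rewrite ltr0n.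
set x := p - p1; have x0 : 0 <= x by rewrite subr_ge0.
have x1 : x <= 1 by rewrite /x lerBlDr; apply: le_trans ple1 _; rewrite lerDl ltW.
pose y := x * n%:R ^+ 2 / (2 * C).
have y0 : 0 <= y by rewrite divr_ge0 ?mulr_ge0 ?exprn_ge0 // ltW.
pose m := (Num.truncn y).+1.
have mlt : y < m%:R by apply: truncnS_gt.
have mle : (m.-1)%:R <= y by rewrite /m /= truncn_le.
have q01 := pair_weight01 (n := n) (p := p) (introT andP (conj (ltW p0) ple1)).
set N : R := #|copies W G n|%:R.
have N0 : 0 < N by rewrite ltr0n copies_gt0.
have pe0 : 0 < p ^+ e' by rewrite exprn_gt0.
pose B := N * p ^+ e' * (1 + x / 2).
have tp : 1 + x <= t * p ^+ ne_root W G.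
  have -> : t * p ^+ ne_root W G = (p / p1) ^+ ne_root W G.
    have p1X0 : p1 ^+ ne_root W G != 0 by rewrite gt_eqF // exprn_gt0.
    by rewrite expr_div_n; apply: (mulIf p1X0); rewrite divfK // mulrAC p1X mul1r.
  apply: (@le_trans _ _ (p / p1)).
    rewrite ler_pdivlMr // mulrDl mul1r -lerBrDl.
    by rewrite -[leRHS]mulr1 -/x ler_wpM2l // ltW.
  rewrite -[leLHS]expr1; apply: ler_weXn2l => //.
  by rewrite ler_pdivlMr // mul1r.
have tail : upper_tail W G n p t <=
    (B / (t * (N * p ^+ ne G))) ^+ m.
  rewrite upper_tailE -/N.
  have l0 : 0 < t * (N * p ^+ ne G) by rewrite !mulr_gt0 ?exprn_gt0.
  pose Y S := ncontained (copies W G n) (fun K => edges K :\: root_pairs W n) S.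
  apply: (@le_trans _ _ (\sum_(S | t * (N * p ^+ ne G) <= (Y S)%:R) bmass (pair_weight p) S)).
    rewrite big_mkcond [leRHS]big_mkcond /=; apply: ler_sum => S _.
    have XY : (ncop W G S)%:R <= (Y S)%:R :> R.
      rewrite ler_nat; apply/subset_leq_card/subsetP => K; rewrite !inE => /andP[-> sK].
      exact: subset_trans (subsetDl _ _) sK.
    case: ifP => [/le_trans/(_ XY) ->//|_]; case: ifP => // _; exact: bmass_ge0.
  apply: (ncontained_tail (d := ne G) q01) => //.
    by move=> K KC; rewrite (card_copy_nonroot WG KC) (ne_rootD W G) leq_addl.
  move=> F leF; apply: le_trans (sum_overlap_nonroot d F p01) _.
  apply: (@le_trans _ _ (N * p ^+ e' + A * N * #|F|%:R / n%:R ^+ 2)).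
    rewrite lerD2l; apply: (@le_trans _ _ (\sum_(e in edges (del G W))
        (emb_const R W * (copy_const G)%:R * N * #|F|%:R / n%:R ^+ 2))).
      apply: ler_sum => e eE; rewrite ler_pdivlMr ?exprn_gt0 //; exact: card_embs_edge.
    rewrite sumr_const -[leLHS]mulr_natl -/(ne _) -/e' /A le_eqVlt; apply/orP; left.
    apply/eqP; move: e'%:R (emb_const R W) (copy_const G)%:R #|F|%:R => z1 z2 z3 z4.
    by field; rewrite gt_eqF.
  have leF' : #|F|%:R <= y * (ne G)%:R.
    apply: (@le_trans _ _ ((m.-1 * ne G)%N%:R)); first by rewrite ler_nat.
    by rewrite natrM ler_wpM2r.
  rewrite /B mulrDr mulr1 lerD2l.
  apply: (@le_trans _ _ (A * N * (y * (ne G)%:R) / n%:R ^+ 2)).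
    by rewrite ler_wpM2r ?invr_ge0 ?exprn_ge0 // ler_wpM2l // mulr_ge0 // ltW.
  rewrite (_ : _ / _ = N * (A * (ne G)%:R / C) * (x / 2)); last first.
    rewrite /y; move: (lt0r_neq0 C0) (lt0r_neq0 nR).
    by move: (C) (A) (ne G)%:R => c a z c0 nz; field; rewrite c0.
  rewrite ler_wpM2r ?divr_ge0 // ler_wpM2l ?(ltW N0) //.
  rewrite ler_pdivrMr //; apply: (@le_trans _ _ (p1 ^+ e' * C)).
    rewrite /C mulrDr mulrCA mulfV ?gt_eqF ?exprn_gt0 // !mulr1 lerDl.
    by rewrite exprn_ge0 ?(ltW p1_gt0).
  by rewrite ler_wpM2r ?(ltW C0) // lerXn2r ?nnegrE ?(ltW p0) ?(ltW p1_gt0).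
have ratio : B / (t * (N * p ^+ ne G)) <= expR (- (x / 4)).
  rewrite (ne_rootD W G) -/e' exprD /B.
  rewrite (_ : _ / _ = (1 + x / 2) / (t * p ^+ ne_root W G)); last first.
    move: (lt0r_neq0 t0) (lt0r_neq0 N0) (lt0r_neq0 pe0).
    move: (lt0r_neq0 (exprn_gt0 (ne_root W G) p0)).
    move: (N) (p ^+ e') (p ^+ ne_root W G) (x) => a b c z c0 t_neq0 a0 b0.
    by field; rewrite a0 b0 c0 t_neq0.
  apply: (@le_trans _ _ ((1 + x / 2) / (1 + x))).
    rewrite ler_wpM2l ?addr_ge0 ?divr_ge0 // lef_pV2 ?posrE //.
      by rewrite mulr_gt0 ?exprn_gt0.
    by rewrite ltr_wpDr.
  apply: le_trans (expR_ge1Dx _); rewrite ler_pdivrMr ?ltr_wpDr //.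
  by apply: half_ratio_le; rewrite x0.
apply: le_trans tail _.
apply: (@le_trans _ _ (expR (- (x / 4)) ^+ m)).
  rewrite lerXn2r ?nnegrE ?expR_ge0 // divr_ge0 //.
    by rewrite mulr_ge0 ?addr_ge0 ?divr_ge0 // mulr_ge0 ?(ltW N0) ?(ltW pe0).
  by rewrite ltW // !mulr_gt0 // exprn_gt0.
rewrite -expRM_natl ler_expR mulrN lerN2.
apply: (@le_trans _ _ (y * (x / 4))).
  rewrite /y le_eqVlt; apply/orP; left; apply/eqP.
  by move: (lt0r_neq0 C0); move: (C) => c c0; field.
by rewrite ler_wpM2r ?divr_ge0 // ltW.
Qed.

End Concentration.

(** * Lower bounds by planting and change of measure *)

Lemma chi_square_factor (R : realFieldType) (p q : R) : 0 < p < 1 ->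
  q ^+ 2 / p + (1 - q) ^+ 2 / (1 - p) = 1 + (q - p) ^+ 2 / (p * (1 - p)).
Proof.
move=> /andP[p0 p1]; field.
by apply/andP; split; apply/negP => /eqP; lra.
Qed.

Section PlantedLowerBound.
Variables (R : realType) (T : finType) (W : {set T}) (G : graph T).
Hypotheses (WG : rooted W G) (eW_gt0 : (0 < ne_root W G)%N).
Variable t : R.
Hypothesis t_gt1 : 1 < t.

Lemma planted_lower n (p : R) (S0 : {set {set 'I_n}}) : 0 <= p <= 1 ->
  S0 \subset pairs n ->
  t * (#|copies W G n|%:R * p ^+ ne G) <= (ncop W G S0)%:R ->
  p ^+ #|S0| <= upper_tail W G n p t.
Proof.
move=> p01 sS0 le; rewrite upper_tailE -prod_pair_weight //.
apply: bmass_event_sup; first exact: pair_weight01.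
move=> S sS; apply: le_trans le _; rewrite ler_nat.
apply/subset_leq_card/subsetP => K; rewrite !inE => /andP[-> sK].
exact: subset_trans sK sS.
Qed.

Lemma full_lower n (p : R) : 0 <= p <= 1 -> t * p ^+ ne G <= 1 ->
  p ^+ 'C(n, 2) <= upper_tail W G n p t.
Proof.
move=> p01 tp; rewrite -card_pairs; apply: planted_lower => //.
rewrite (_ : ncop W G (pairs n) = #|copies W G n|).
  by rewrite mulrCA ler_piMr.
by apply: eq_card => K; rewrite in_set edges_pairs andbT.
Qed.

Lemma tilted_lower n (p theta : R) (q : {set 'I_n} -> R) :
  (nv G <= n)%N -> 0 < p < 1 -> (forall u, 0 <= q u <= 1) ->
  (forall u, u \notin pairs n -> q u = 0) -> 0 <= theta ->
  t * (#|copies W G n|%:R * p ^+ ne G) + theta * #|copies W G n|%:R <=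
    \sum_(K in copies W G n) \prod_(u in edges K) q u ->
  theta ^+ 2 <= upper_tail W G n p t *
    \prod_(u in pairs n) (1 + (q u - p) ^+ 2 / (p * (1 - p))).
Proof.
move=> leVn /andP[p0 p1] q01 q0 th0 le; rewrite upper_tailE.
set l := t * _ in le *.
have N0 : (0 : R) < #|copies W G n|%:R by rewrite ltr0n copies_gt0.
have l0 : 0 <= l by rewrite /l ltW // mean_gt0.
have thQ : theta <= \sum_(S | l <= (ncop W G S)%:R) bmass q S.
  rewrite -(ler_pM2l N0) mulrC; apply: le_trans (ncontained_ge_prob _ _ q01 l0).
  by rewrite lerBrDl.
have -> : \prod_(u in pairs n) (1 + (q u - p) ^+ 2 / (p * (1 - p))) =
    \prod_u (q u ^+ 2 / pair_weight p u + (1 - q u) ^+ 2 / (1 - pair_weight p u)).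
  rewrite [LHS]big_mkcond; apply: eq_bigr => u _.
  rewrite /pair_weight; have := q0 u; rewrite inE; case: ifP => u2 qu.
    by rewrite chi_square_factor // p0.
  by rewrite qu // expr0n mul0r add0r !subr0 expr1n divr1.
apply: le_trans (change_of_measure _ _ _ q01).
- by rewrite lerXn2r ?nnegrE // (le_trans th0).
- by move=> u; rewrite /pair_weight; case: ifP => _; rewrite ?lexx ?ltr01 ?(ltW p0).
- move=> u; rewrite /pair_weight; case: ifP => u2 pu.
    by move: p0; rewrite pu ltxx.
  by apply: q0; rewrite inE u2.
Qed.

(** The three groups of factors make up for the ratio 2 t to be gained, for
passing between embeddings and copies, and for rounding the sizes of the parts
of the blow-up. *)
Definition blowup_const : R :=
  2 * t * (#|W| ^ #|W|)%:R * (nv G ^ nv G)%:R * (2 ^+ (nv G).+1 * (2 * nv G)%:R ^+ nv G).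

Lemma prod_powR (I : finType) (P : pred I) (L : R) (x : I -> R) : 0 < L ->
  \prod_(i | P i) L `^ x i = L `^ (\sum_(i | P i) x i).
Proof.
move=> L0; rewrite (big_morph (powR L) (id1 := 1) (op1 := *%R)) ?powRr0 // => a b.
by rewrite powRD // (gt_eqF L0) implybT.
Qed.

(** Vertex i of H - R is replaced by a part of size floor (L ^ x_i), where x is a
nearly optimal fractional independent assignment, and the roots are kept. As
x_i + x_j <= 1 on edges, every edge of H becomes at most L edges, while the
number of copies of H is about L ^ alpha. The hypothesis says that this exceeds
the expected number Psi_H by a large constant, so planting these edges raises
the mean above 2 t mu. *)
Lemma blowup_lower n (p L : R) (H : graph T) : (nv G <= n)%N -> 0 < p < 1 ->
  subgraph H G -> (0 < ne H)%N -> 1 <= L <= (block_size W G n)%:R ->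
  blowup_const * Psi W H n p <= L `^ frac_indep R (del H W) ->
  p `^ ((ne G)%:R * (2 + L)) <= upper_tail W G n p t.
Proof.
move=> leVn /andP[p0 p1] sH eH /andP[L1 La] leL.
have t0 : 0 < t := lt_trans ltr01 t_gt1.
have n0 := ambient_gt0 WG eW_gt0 leVn; pose d := Ordinal n0.
have L0 : 0 < L := lt_le_trans ltr01 L1.
have v0 : (0 < nv G)%N by apply: leq_ltn_trans (card_roots_lt WG eW_gt0).
have [sVH sEH] := andP sH; have [WV _] := WG.
set U := vertices (del H W); have UE : U = vertices H :\: W by [].
have sU : U \subset vertices G :\: W by rewrite UE setSD.
set al := frac_indep R (del H W) in leL.
have [xi [xi01 xi_adj] xi_sum] : exists2 xi, frac_indep_assignment (del H W) xi &
    L `^ al <= 2 * L `^ (\sum_(i in U) xi i).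
  have lnL : 0 <= ln L by rewrite ln_ge0.
  (* This error in the exponent costs at most a factor 2. *)
  have eps0 : 0 < ln 2 / (1 + ln L) by rewrite divr_gt0 ?ln_gt0 ?ltr1n // ltr_wpDr.
  have [xi Hxi /ltW xis] := frac_indep_adherent (del H W) eps0.
  exists xi => //; rewrite lerBlDr -/al in xis.
  apply: (@le_trans _ _ (L `^ (\sum_(i in U) xi i + ln 2 / (1 + ln L)))).
    exact: ler_powR.
  rewrite powRD ?(gt_eqF L0) ?implybT // mulrC ler_wpM2r ?powR_ge0 //.
  rewrite /powR (gt_eqF L0) -[leRHS]lnK ?posrE // ler_expR.
  by rewrite mulrAC ler_pdivrMr ?ltr_wpDr // ler_wpM2l ?ln_ge0 ?ler1n // lerDr.
pose b x := if x \in U then Num.truncn (L `^ xi x) else block_size W G n.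
have xi_itv x : x \in U -> 0 <= xi x <= 1 by apply: xi01.
have trunc_le x : x \in U -> (Num.truncn (L `^ xi x))%:R <= L `^ xi x.
  by move=> xU; rewrite truncn_le powR_ge0.
have b_le x : x \in vertices G :\: W -> (b x <= block_size W G n)%N.
  move=> _; rewrite /b; case: ifP => // xU; rewrite -(ler_nat R).
  apply: le_trans (trunc_le _ xU) _; apply: le_trans La.
  by rewrite ler1_powR //; have /andP[] := xi_itv x xU.
set fam := family (block W G d b).
have famE f : f \in fam -> f \in embs W G d.
  exact: (family_block_embs WG (card_roots_lt WG eW_gt0) leVn b_le).
pose F := \bigcup_(f in fam) edge_image f (edges H).
have sF : F \subset pairs n.
  apply/bigcupsP => f /famE/embsP[f_inj _ _]; apply/subsetP => _ /imsetP[e eH' ->].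
  by rewrite inE (edge_image_card2 f_inj) // (subsetP sEH).
have cardF : #|F|%:R <= (ne G)%:R * L.
  have cov : (#|F| <= \sum_(e in edges H) #|[set f @: (e : {set T}) | f : {ffun T -> 'I_n} in fam]|)%N.
    apply: card_le_sum_cover => u /bigcupP[f fam_f /imsetP[e eH' ->]].
    by exists e => //; apply: imset_f.
  apply: (@le_trans _ _ (\sum_(e in edges H) L)); last first.
    rewrite sumr_const -[leLHS]mulr_natl ler_wpM2r ?(ltW L0) // ler_nat.
    exact: subset_leq_card.
  apply: (@le_trans _ _ (\sum_(e in edges H) (#|[set f @: (e : {set T}) | f : {ffun T -> 'I_n} in fam]|)%:R)).
    by rewrite -natr_sum ler_nat.
  apply: ler_sum => e eH'.
  have [eV /eqP/cards2P[x [y [xy exy]]]] := edgeP eH'.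
  have [xV yV] : x \in vertices H /\ y \in vertices H.
    by split; apply: (subsetP eV); rewrite exy !inE eqxx ?orbT.
  pose beta z := if z \in W then 0 else xi z.
  have blk z : z \in vertices H -> (#|block W G d b z|)%:R <= L `^ beta z.
    move=> zV; rewrite (card_block d WG (card_roots_lt WG eW_gt0) leVn b_le) inE /beta.
    case: (boolP (z \in W)) => zW /=; first by rewrite powRr0.
    have zU : z \in U by rewrite UE inE zW.
    by rewrite (subsetP sVH) //= /b zU; apply: trunc_le.
  have beta_le : beta x + beta y <= 1.
    rewrite /beta; case: ifPn => xW; case: ifPn => yW; rewrite ?addr0 ?add0r ?ler01 //.
    + by have /andP[] : 0 <= xi y <= 1 by apply: xi_itv; rewrite UE inE yW.
    + by have /andP[] : 0 <= xi x <= 1 by apply: xi_itv; rewrite UE inE xW.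
    apply: xi_adj; rewrite /adj -exy inE eH' /= exy -setI_eq0.
    apply/eqP/setP => z; rewrite !inE.
    by apply/negP => /andP[/orP[]/eqP ->]; apply/negP.
  apply: (@le_trans _ _ ((#|block W G d b x| * #|block W G d b y|)%N%:R)).
    rewrite ler_nat -cardsX; pose mk (ab : 'I_n * 'I_n) := [set ab.1; ab.2].
    apply: leq_trans (leq_imset_card mk _); apply/subset_leq_card/subsetP.
    move=> _ /imsetP[f /familyP ff ->]; apply/imsetP; exists (f x, f y).
      by rewrite in_setX !ff.
    by rewrite exy imsetU1 imset_set1.
  rewrite natrM; apply: (@le_trans _ _ (L `^ beta x * L `^ beta y)).
    by apply: ler_pM => //; apply: blk.
  rewrite -powRD ?(gt_eqF L0) ?implybT //; exact: ler1_powR.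
pose q u : R := if u \in F then 1 else pair_weight p u.
have p01 : 0 <= p <= 1 by rewrite !ltW.
have q01 u : 0 <= q u <= 1.
  by rewrite /q; case: ifP => _; rewrite ?ler01 ?lexx //; apply: pair_weight01.
have famcard : L `^ al * (n%:R ^+ (nv G - #|W| - nv (del H W))) <=
    (2 ^+ (nv G).+1 * (2 * nv G)%:R ^+ nv G) * #|fam|%:R.
  have := card_family_block d WG (card_roots_lt WG eW_gt0) leVn b_le.
  rewrite -/fam => ->; rewrite natr_prod.
  pose s := nv (del H W); pose k := (nv G - #|W| - s)%N.
  have kE : k = #|(vertices G :\: W) :\: U| by rewrite /k cardsDS // cardsDS.
  have low : (L `^ (\sum_(i in U) xi i) / 2 ^+ s) * (n%:R / (2 * nv G)%:R) ^+ k <=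
      \prod_(x in vertices G :\: W) (b x)%:R.
    rewrite [leRHS](big_setID U) /= (setIidPr sU); apply: ler_pM.
    - by rewrite divr_ge0 ?powR_ge0 ?exprn_ge0.
    - by rewrite exprn_ge0 // divr_ge0.
    - rewrite -prod_powR // (_ : 2 ^+ s = \prod_(i in U) (2 : R)); last by rewrite prodr_const.
      rewrite -prodf_div; apply: ler_prod => x xU; rewrite divr_ge0 ?powR_ge0 //=.
      rewrite /b xU ler_pdivrMr //.
      have x1 : 1 <= L `^ xi x.
        by rewrite -(powRr0 L); apply: ler_powR => //; have /andP[] := xi_itv x xU.
      have t1 : (1 <= Num.truncn (L `^ xi x))%N by rewrite truncn_gt0.
      apply: (@le_trans _ _ ((Num.truncn (L `^ xi x)).+1%:R)).
        by rewrite ltW // truncnS_gt.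
      by rewrite -natrM ler_nat muln2 -addnn -addn1 leq_add2l.
    - rewrite kE -prodr_const; apply: ler_prod => x /setDP[xV xU].
      rewrite divr_ge0 //= /b (negPf xU) ler_pdivrMr ?ltr0n ?muln_gt0 //.
      by rewrite -natrM ler_nat mulnC n_le_block_size.
  have s_le : (s <= nv G)%N.
    by apply: leq_trans (subset_leq_card sU) _; rewrite subset_leq_card // subsetDl.
  have k_le : (k <= nv G)%N by rewrite /k -subnDA leq_subr.
  apply: le_trans (ler_wpM2l _ low); last by rewrite mulr_ge0 ?exprn_ge0.
  rewrite [leRHS](_ : _ = (2 ^+ (nv G) / 2 ^+ s) * ((2 * nv G)%:R ^+ nv G / (2 * nv G)%:R ^+ k) *
     ((2 * L `^ (\sum_(i in U) xi i)) * n%:R ^+ k)); last first.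
    rewrite expr_div_n [in LHS]exprS.
    move: (L `^ _) (2 ^+ nv G) (2 ^+ s)^-1 ((2 * nv G)%:R ^+ nv G) => z1 z2 z3 z4.
    by move: (_ ^+ k) (_ ^+ k)^-1 => z5 z6; ring.
  rewrite -[leLHS]mul1r; apply: ler_pM => //.
  - by rewrite mulr_ge0 ?powR_ge0 ?exprn_ge0.
  - have ge1 (z : R) (i : nat) : (i <= nv G)%N -> 1 <= z -> 1 <= z ^+ nv G / z ^+ i.
      move=> le z1; rewrite ler_pdivlMr ?mul1r ?exprn_gt0 ?(lt_le_trans ltr01) //.
      exact: ler_weXn2l.
    rewrite -[leLHS]mulr1; apply: ler_pM => //; apply: ge1; rewrite ?ler1n //.
    by rewrite muln_gt0.
  - by rewrite ler_wpM2r ?exprn_ge0.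
set N : R := #|copies W G n|%:R.
have mean_le : 2 * t * (N * p ^+ ne G) <= \sum_(K in copies W G n) \prod_(u in edges K) q u.
  pose g (S : {set {set 'I_n}}) := \prod_(u in S) q u.
  have g0 S : 0 <= g S by apply: prodr_ge0 => u _; have /andP[] := q01 u.
  have [_ up] := sum_embs_copies d WG g0.
  have vv0 : (0 : R) < (nv G ^ nv G)%:R by rewrite ltr0n expn_gt0 v0.
  rewrite -(ler_pM2l vv0); apply: le_trans up.
  apply: (@le_trans _ _ (\sum_(f in fam) p ^+ (ne G - ne H))); last first.
    rewrite [leRHS](bigID (fun f => f \in fam)) /= -[leLHS]addr0; apply: lerD; last exact: sumr_ge0.
    rewrite [leRHS](eq_bigl (fun f => f \in fam)); last first.
      by move=> f; case fam_f: (f \in fam); rewrite ?andbF // famE.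
    apply: ler_sum => f fam_f; have [f_inj _ _] := embsP (famE f fam_f).
    rewrite /g (big_setID F) /= big1 => [|u /setIP[_ uF]]; last by rewrite /q uF.
    rewrite mul1r (eq_bigr (pair_weight p)) => [|u /setDP[_ uF]]; last by rewrite /q (negPf uF).
    have sI : edge_image f (edges G) \subset pairs n.
      by apply/subsetP => _ /imsetP[e eG ->]; rewrite inE (edge_image_card2 f_inj).
    rewrite prod_pair_weight; last exact: subset_trans (subsetDl _ _) sI.
    apply: ler_wiXn2l; rewrite ?(ltW p0) ?(ltW p1) //.
    apply: (@leq_trans #|edge_image f (edges G) :\: edge_image f (edges H)|).
      by apply/subset_leq_card/setDS; apply: (bigcup_max f).
    rewrite cardsDS ?imsetS // !card_in_imset //.
    - by move=> e e' /(subsetP sEH) eG /(subsetP sEH); apply: (imset_edges_inj f_inj).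
    - exact: (imset_edges_inj f_inj).
  rewrite sumr_const -[leRHS]mulr_natl.
  have N_le : N <= (#|W| ^ #|W|)%:R * n%:R ^+ (nv G - #|W|).
    rewrite /N -natrX -natrM ler_nat; have [le1 _] := card_copies_embs R d WG.
    exact: leq_trans le1 (card_embs_le d WG (card_roots_le_n WG eW_gt0 leVn)).
  have D0 : 0 < 2 ^+ (nv G).+1 * (2 * nv G)%:R ^+ nv G :> R.
    by rewrite mulr_gt0 ?exprn_gt0 // ltr0n muln_gt0.
  rewrite -(ler_pM2l D0) [leRHS]mulrA.
  apply: (@le_trans _ _ (blowup_const * Psi W H n p *
      n%:R ^+ (nv G - #|W| - nv (del H W)) * p ^+ (ne G - ne H))); last first.
    rewrite ler_wpM2r ?exprn_ge0 ?(ltW p0) //; apply: le_trans famcard.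
    by rewrite ler_wpM2r ?exprn_ge0.
  have eHG : (ne H <= ne G)%N by apply: ne_le.
  have sle : (nv (del H W) <= nv G - #|W|)%N by rewrite -cardsDS // subset_leq_card.
  have -> : blowup_const * Psi W H n p * n%:R ^+ (nv G - #|W| - nv (del H W)) *
       p ^+ (ne G - ne H) = (2 ^+ (nv G).+1 * (2 * nv G)%:R ^+ nv G) *
       ((nv G ^ nv G)%:R * (2 * t * ((#|W| ^ #|W|)%:R * n%:R ^+ (nv G - #|W|) * p ^+ ne G))).
    rewrite /blowup_const /Psi -[in RHS](subnK sle) -[in RHS](subnK eHG) !exprD.
    move: (2 ^+ (nv G).+1) ((2 * nv G)%:R ^+ nv G) (nv G ^ nv G)%N%:R => z1 z2 z3.
    move: (#|W| ^ #|W|)%N%:R (n%:R ^+ _) (n%:R ^+ _) (p ^+ _) (p ^+ _) => z4 z5 z6 z7 z8.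
    by ring.
  rewrite ler_wpM2l ?(ltW D0) // ler_wpM2l ?(ltW vv0) // ler_wpM2l ?mulr_ge0 ?(ltW t0) //.
  by rewrite ler_wpM2r ?exprn_ge0 ?(ltW p0).
pose theta := t * p ^+ ne G.
have th0 : 0 <= theta by rewrite mulr_ge0 ?exprn_ge0 ?ltW.
have := @tilted_lower n p theta q leVn _ q01 _ th0 _.
rewrite p0 p1 => /(_ isT) com.
have {com} : theta ^+ 2 <= upper_tail W G n p t *
    \prod_(u in pairs n) (1 + (q u - p) ^+ 2 / (p * (1 - p))).
  apply: com => [u uP|].
    rewrite /q ifN; last by apply: contra uP => /(subsetP sF).
    by move: uP; rewrite inE /pair_weight => /negPf ->.
  apply: le_trans mean_le; rewrite /theta -/N le_eqVlt; apply/orP; left; apply/eqP.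
  by move: (N) (p ^+ ne G) => z1 z2; ring.
have -> : \prod_(u in pairs n) (1 + (q u - p) ^+ 2 / (p * (1 - p))) = (p ^+ #|F|)^-1.
  rewrite (big_setID F) /= (setIidPr sF) [X in _ * X]big1 => [|u /setDP[uP uF]].
    rewrite mulr1 -exprVn -prodr_const; apply: eq_bigr => u uF; rewrite /q uF.
    by rewrite -chi_square_factor ?p0 // subrr expr0n mul0r addr0 expr1n div1r.
  move: uP; rewrite /q (negPf uF) inE /pair_weight => ->.
  by rewrite subrr expr0n mul0r addr0.
rewrite ler_pdivlMr ?exprn_gt0 // => com; apply: le_trans com.
rewrite mulrDr powRD ?(gt_eqF p0) ?implybT //; apply: ler_pM; rewrite ?powR_ge0 //.
  rewrite -natrM powR_mulrn ?(ltW p0) // mulnC exprM /theta.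
  rewrite -exprM mulnC exprM lerXn2r ?nnegrE ?exprn_ge0 ?(ltW p0) //.
  by rewrite ler_peMl ?exprn_ge0 ?(ltW p0) // ltW.
rewrite -powR_mulrn ?(ltW p0) //; apply: ger_powR => //; by rewrite p0 ltW.
Qed.

End PlantedLowerBound.

Lemma bin2_le n : ('C(n, 2) <= n ^ 2)%N.
Proof.
rewrite bin2 -divn2; apply: leq_trans (leq_div _ _) _.
by rewrite -mulnn leq_mul2l leq_pred orbT.
Qed.

Lemma superadditiveX (R : realDomainType) (a b : R) k : 0 <= a -> 0 <= b ->
  (0 < k)%N -> a ^+ k + b ^+ k <= (a + b) ^+ k.
Proof.
move=> a0 b0; case: k => // k _; elim: k => [|k IHk]; first by rewrite !expr1.
rewrite !(exprS _ k.+1); apply: (@le_trans _ _ ((a + b) * (a ^+ k.+1 + b ^+ k.+1))).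
  rewrite mulrDl !mulrDr -!exprS -addrA lerD2l addrA lerDr addr_ge0 //.
    by rewrite mulr_ge0 ?exprn_ge0.
  by rewrite mulr_ge0 ?exprn_ge0.
by rewrite ler_wpM2l ?addr_ge0.
Qed.

Lemma subX_le (R : realDomainType) (a b : R) k : 0 <= a <= b -> b <= 1 ->
  b ^+ k - a ^+ k <= k%:R * (b - a).
Proof.
move=> /andP[a0 ab] b1; elim: k => [|k IHk]; first by rewrite subrr mul0r.
have b0 := le_trans a0 ab.
rewrite !exprS (_ : _ - _ = b * (b ^+ k - a ^+ k) + (b - a) * a ^+ k); last by ring.
rewrite -natr1 [leRHS]mulrDl mul1r; apply: lerD.
  apply: (@le_trans _ _ (b * (k%:R * (b - a)))); first by rewrite ler_wpM2l.
  by rewrite ler_piMl // mulr_ge0 // subr_ge0.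
by rewrite ler_piMr ?subr_ge0 // exprn_ile1 // (le_trans ab).
Qed.

Lemma card_root_pairs (T : finType) (W : {set T}) n : (#|W| <= n)%N ->
  (#|root_pairs W n| <= #|W| * n)%N.
Proof.
move=> Wn; rewrite -{1}(card_roots Wn) -[X in (_ <= _ * X)%N]card_ord -cardsT -cardsX.
pose mk (ab : 'I_n * 'I_n) := [set ab.1; ab.2].
apply: leq_trans (leq_imset_card mk _); apply/subset_leq_card/subsetP => u.
rewrite !inE -setI_eq0 => /andP[/cards2P[a [b [ab ->]]] /set0Pn[x]].
rewrite !inE => /andP[/orP[]/eqP -> xW]; apply/imsetP.
  by exists (a, b) => //; rewrite in_setX !inE /= xW.
by exists (b, a); [rewrite in_setX !inE /= xW | rewrite /mk /= setUC].
Qed.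

Lemma exp_shift_bound (R : realFieldType) (K x n : R) : 1 <= n ->
  (K * x * n + 1) ^+ 2 <= 2 * (K ^+ 2 + 1) * (n + x ^+ 2 * n ^+ 2).
Proof.
move=> n1; have h1 : 0 <= (K * x * n - 1) ^+ 2 by apply: sqr_ge0.
have h2 : 0 <= K ^+ 2 * n by rewrite mulr_ge0 ?sqr_ge0 // (le_trans ler01).
have h3 : 0 <= (x * n) ^+ 2 by apply: sqr_ge0.
apply: (@le_trans _ _ (2 * (K * x * n) ^+ 2 + 2)); first by rewrite -subr_ge0; nra.
rewrite -subr_ge0 (_ : _ - _ = 2 * (K ^+ 2 * n) + 2 * (n - 1) + 2 * (x * n) ^+ 2); last by ring.
by move: h2 h3; move: (K ^+ 2 * n) ((x * n) ^+ 2) => a b a0 b0; lra.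
Qed.

Section DenseLowerBound.
Variables (R : realType) (T : finType) (W : {set T}) (G : graph T).
Hypotheses (WG : rooted W G) (eW_gt0 : (0 < ne_root W G)%N).
Variable t : R.
Hypothesis t_gt1 : 1 < t.

Let p1 : R := root_threshold t (ne_root W G).
Let p2 : R := root_threshold t (ne G).

(** All pairs at the roots are given probability 1, at the cost exp(- O(n)). The
required mean t mu then corresponds to a density of at most p + K x for the other
pairs, and raising it further by 1/n leaves a margin of n ^ - e(G - R) N, at the
total cost exp(- O((K x + 1/n) ^ 2 n ^ 2)). If this raised density reaches 1,
then x + 1/n is bounded below and the complete graph is cheap enough; if all
edges of G are at roots, planting the pairs at the roots already gives all
copies. *)
Lemma dense_lower (eps : R) : 0 < eps < 1 -> exists2 C : R, 0 < C &
  forall n (p x : R), (nv G <= n)%N -> eps <= p <= p2 -> 0 <= x -> p - p1 <= x ->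
    expR (- (C * (n%:R + x ^+ 2 * n%:R ^+ 2))) <= upper_tail W G n p t.
Proof.
move=> /andP[eps0 eps1].
have t0 : 0 < t := lt_trans ltr01 t_gt1.
have eG0 := ne_gt0 eW_gt0.
have p1_gt0 : 0 < p1 := root_threshold_gt0 t_gt1 _.
have p2_lt1 : p2 < 1 := root_threshold_lt1 t_gt1 eG0.
pose l := - ln eps; have l0 : 0 < l by rewrite oppr_gt0 ln_lt0 // eps0.
have powl p k : eps <= p -> expR (- (l * k%:R)) <= p ^+ k.
  move=> ep; rewrite /l mulNr opprK expRM_natr lnK ?posrE //.
  by rewrite lerXn2r ?nnegrE ?(ltW eps0) // (le_trans (ltW eps0)).
pose K := t * (ne_root W G)%:R.
have K0 : 0 <= K by rewrite mulr_ge0 // ltW.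
pose B := 2 * (K ^+ 2 + 1).
have B0 : 0 < B by rewrite mulr_gt0 // ltr_wpDl // sqr_ge0.
pose D := (eps * (1 - p2))^-1.
have D0 : 0 < D by rewrite invr_gt0 mulr_gt0 // subr_gt0.
pose e' := ne (del G W).
pose CA := l * #|W|%:R; pose CB := l * (B / (1 - p2) ^+ 2).
pose CC := 2 * e'%:R + D * B.
have CA0 : 0 <= CA by rewrite mulr_ge0 // ltW.
have sq0 : 0 < (1 - p2) ^+ 2 by rewrite exprn_gt0 // subr_gt0.
have CB0 : 0 <= CB by rewrite mulr_ge0 ?divr_ge0 // ltW.
have CC0 : 0 < CC by rewrite ltr_wpDl ?(mulr_gt0 D0 B0) // mulr_ge0.
exists (CA + CB + CC); first by rewrite ltr_wpDl // addr_ge0.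
move=> n p x leVn /andP[ep pp2] x0 px.
have p0 : 0 < p := lt_le_trans eps0 ep.
have pl1 : p < 1 := le_lt_trans pp2 p2_lt1.
have p01 : 0 <= p <= 1 by rewrite !ltW.
have n0 := ambient_gt0 WG eW_gt0 leVn.
have nR1 : (1 : R) <= n%:R by rewrite ler1n.
have nR0 : (0 : R) < n%:R := lt_le_trans ltr01 nR1.
have Wn := card_roots_le_n WG eW_gt0 leVn.
set N : R := #|copies W G n|%:R.
have N0 : 0 < N by rewrite ltr0n copies_gt0.
set Z := n%:R + x ^+ 2 * n%:R ^+ 2.
have Zn : n%:R <= Z by rewrite lerDl mulr_ge0 ?exprn_ge0.
have Z0 : 0 <= Z := le_trans (ltW nR0) Zn.
have weaken C' : C' <= CA + CB + CC -> expR (- (C' * Z)) <= upper_tail W G n p t ->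
    expR (- ((CA + CB + CC) * Z)) <= upper_tail W G n p t.
  by move=> le; apply: le_trans; rewrite ler_expR lerN2 ler_wpM2r.
have tp2 : t * p ^+ ne G <= 1 by rewrite -le_root_threshold ?(ltW p0).
have [e'0|e'0] := posnP e'.
  apply: (weaken CA); first by rewrite -addrA lerDl addr_ge0 // ltW.
  apply: (@le_trans _ _ (p ^+ #|root_pairs W n|)).
    apply: (@le_trans _ _ (p ^+ (#|W| * n))).
      apply: le_trans (powl _ _ ep); rewrite ler_expR lerN2 natrM mulrA.
      by rewrite ler_wpM2l.
    by apply: ler_wiXn2l; rewrite ?(ltW p0) ?(ltW pl1) // card_root_pairs.
  apply: (planted_lower p01); first by apply/subsetP => u /setIdP[].
  rewrite (_ : ncop W G (root_pairs W n) = #|copies W G n|).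
    by rewrite -/N mulrCA ler_piMr // ltW.
  apply: eq_card => K'; rewrite in_set; apply: andb_idr => KC.
  by rewrite -setD_eq0 -cards_eq0 (card_copy_nonroot WG KC) -/e' e'0.
have teR : t * p ^+ ne_root W G <= 1 + K * x.
  have [le|lt] := leP p p1.
    apply: (@le_trans _ _ 1); last by rewrite lerDl mulr_ge0.
    by rewrite -le_root_threshold // ltW.
  rewrite -(root_thresholdX t_gt1 eW_gt0) -lerBlDl -mulrBr -/p1 /K -mulrA.
  rewrite ler_wpM2l ?(ltW t0) //.
  apply: (@le_trans _ _ ((ne_root W G)%:R * (p - p1))); last by rewrite ler_wpM2l.
  by apply: subX_le; rewrite ?(ltW pl1) // !ltW.
have Kx0 : 0 <= K * x := mulr_ge0 K0 x0.
have tpe : t * p ^+ ne G <= (p + K * x) ^+ e'.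
  rewrite (ne_rootD W G) -/e' exprD mulrA.
  apply: (@le_trans _ _ ((1 + K * x) * p ^+ e')); first by rewrite ler_wpM2r ?exprn_ge0 // ltW.
  rewrite -(prednK e'0) !exprS mulrA; apply: ler_pM.
  - by rewrite mulr_ge0 ?addr_ge0 ?Kx0 ?(ltW p0) //.
  - by rewrite exprn_ge0 // ltW.
  - by rewrite mulrDl mul1r lerD2l ler_piMr ?Kx0 // ltW.
  - have le : p <= p + K * x by rewrite lerDl.
    by rewrite lerXn2r ?nnegrE // ?(le_trans _ le) ?(ltW p0).
pose y := K * x + n%:R^-1.
have y0 : 0 <= y by rewrite addr_ge0 ?Kx0 // invr_ge0 ltW.
have yn : y ^+ 2 * n%:R ^+ 2 <= B * Z.
  rewrite -exprMn (_ : y * n%:R = K * x * n%:R + 1); last by rewrite mulrDl mulVf // gt_eqF.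
  exact: exp_shift_bound.
have [le1|lt1] := leP 1 (p + y).
  apply: (weaken CB); first by rewrite addrAC lerDr addr_ge0 // ltW.
  apply: le_trans (full_lower W n p01 tp2).
  apply: (@le_trans _ _ (p ^+ (n ^ 2))); last first.
    apply: ler_wiXn2l; rewrite ?(ltW p0) ?(ltW pl1) //.
    exact: bin2_le.
  apply: le_trans (powl _ _ ep); rewrite ler_expR lerN2 /CB -mulrA ler_wpM2l ?(ltW l0) //.
  rewrite mulrAC ler_pdivlMr // natrX; apply: le_trans yn.
  rewrite mulrC ler_wpM2r ?exprn_ge0 ?(ltW nR0) //.
  rewrite lerXn2r ?nnegrE ?subr_ge0 ?(ltW p2_lt1) //.
  rewrite lerBlDr; apply: le_trans le1 _; rewrite addrC lerD2l //.
apply: (weaken (CA + CC)); first by rewrite addrAC lerDl.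
pose q u : R := if u \in root_pairs W n then 1 else pair_weight (p + y) u.
have py01 : 0 <= p + y <= 1 by rewrite addr_ge0 ?(ltW p0) // ltW.
have q01 u : 0 <= q u <= 1.
  by rewrite /q; case: ifP => _; rewrite ?ler01 ?lexx //; apply: pair_weight01.
have sR : root_pairs W n \subset pairs n by apply/subsetP => u /setIdP[].
have q0 u : u \notin pairs n -> q u = 0.
  move=> uP; rewrite /q ifN; last by apply: contra uP => /(subsetP sR).
  by move: uP; rewrite inE /pair_weight => /negPf ->.
have mean : \sum_(K' in copies W G n) \prod_(u in edges K') q u = N * (p + y) ^+ e'.
  rewrite (eq_bigr (fun=> (p + y) ^+ e')) => [|K' KC].
    by rewrite sumr_const mulr_natl.
  rewrite (big_setID (root_pairs W n)) /= big1 => [|u /setIP[_ uR]]; last by rewrite /q uR.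
  rewrite mul1r (eq_bigr (pair_weight (p + y))) => [|u /setDP[_ uR]].
    rewrite prod_pair_weight ?(card_copy_nonroot WG KC) //.
    exact: subset_trans (subsetDl _ _) (edges_pairs K').
  by rewrite /q (negPf uR).
pose theta : R := n%:R^-1 ^+ e'.
have th0 : 0 <= theta by rewrite exprn_ge0 // invr_ge0 ltW.
have p0l1 : 0 < p < 1 by rewrite p0.
have com : theta ^+ 2 <= upper_tail W G n p t *
    \prod_(u in pairs n) (1 + (q u - p) ^+ 2 / (p * (1 - p))).
  apply: (tilted_lower WG eW_gt0 t_gt1 leVn p0l1 q01 q0 th0).
  rewrite mean -/N (_ : t * (N * p ^+ ne G) = N * (t * p ^+ ne G)); last by rewrite mulrCA.
  rewrite [X in _ + X]mulrC -mulrDr ler_wpM2l ?(ltW N0) // /y addrA.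
  apply: le_trans (superadditiveX _ _ e'0); rewrite ?addr_ge0 ?Kx0 ?invr_ge0 ?(ltW p0) //.
  by rewrite lerD2r.
have V_le : \prod_(u in pairs n) (1 + (q u - p) ^+ 2 / (p * (1 - p))) <=
    expR (CA * n%:R + D * y ^+ 2 * n%:R ^+ 2).
  rewrite (big_setID (root_pairs W n)) /= (setIidPr sR) expRD.
  have f0 u : 0 <= 1 + (q u - p) ^+ 2 / (p * (1 - p)).
    by rewrite addr_ge0 // divr_ge0 ?sqr_ge0 // mulr_ge0 ?subr_ge0 ?(ltW p0) ?(ltW pl1).
  apply: ler_pM; try by apply: prodr_ge0 => u _.
    apply: (@le_trans _ _ (\prod_(u in root_pairs W n) expR l)).
      apply: ler_prod => u uR; rewrite f0 /= /q uR.
      rewrite -chi_square_factor // subrr expr0n mul0r addr0 expr1n div1r.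
      rewrite /l expRN lnK ?posrE // lef_pV2 ?posrE //.
    rewrite prodr_const -expRM_natl ler_expR /CA mulrC -mulrA ler_wpM2l ?(ltW l0) //.
    by rewrite -natrM ler_nat card_root_pairs.
  apply: (@le_trans _ _ (\prod_(u in pairs n :\: root_pairs W n) expR (D * y ^+ 2))).
    apply: ler_prod => u /setDP[uP uR]; rewrite f0 /=.
    apply: le_trans (expR_ge1Dx _); rewrite lerD2l /q (negPf uR) /pair_weight.
    move: uP; rewrite inE => ->; rewrite addrAC subrr add0r mulrC.
    rewrite ler_wpM2r ?sqr_ge0 // /D lef_pV2 ?posrE ?mulr_gt0 ?subr_gt0 //.
    by apply: ler_pM; rewrite ?subr_ge0 ?(ltW eps0) ?(ltW p2_lt1) // lerD2l lerN2.
  rewrite prodr_const -expRM_natl ler_expR mulrC ler_wpM2l ?mulr_ge0 ?sqr_ge0 ?(ltW D0) //.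
  rewrite -natrX ler_nat; apply: leq_trans (subset_leq_card (subsetDl _ _)) _.
  by rewrite card_pairs bin2_le.
have th_ge : expR (- (2 * e'%:R * n%:R)) <= theta ^+ 2.
  rewrite /theta -exprM (_ : - _ = (e' * 2)%N%:R * - n%:R); last by rewrite natrM; ring.
  rewrite expRM_natl lerXn2r ?nnegrE ?expR_ge0 ?invr_ge0 ?(ltW nR0) //.
  rewrite expRN lef_pV2 ?posrE ?expR_gt0 //.
  by apply: le_trans (expR_ge1Dx _); rewrite lerDr.
have P0 : 0 <= upper_tail W G n p t.
  by rewrite upper_tailE; apply: sumr_ge0 => S _; apply: bmass_ge0; apply: pair_weight01.
apply: (@le_trans _ _ (expR (- (2 * e'%:R * n%:R) - (CA * n%:R + D * y ^+ 2 * n%:R ^+ 2)))).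
  rewrite ler_expR -opprD lerN2 /CC (mulrDl CA) (mulrDl (2 * _)) addrCA.
  apply: lerD; first by rewrite ler_wpM2l // mulr_ge0.
  apply: lerD; first by rewrite ler_wpM2l.
  by rewrite -!(mulrA D) ler_wpM2l ?(ltW D0).
rewrite expRB ler_pdivrMr ?expR_gt0 //; apply: le_trans th_ge _; apply: le_trans com _.
by rewrite ler_wpM2l.
Qed.

End DenseLowerBound.

(** * The ranges of p *)

Lemma powR_expR_ln (R : realType) (p C : R) : 0 < p -> p `^ C = expR (- (C * ln (1 / p))).
Proof. by move=> p0; rewrite /powR gt_eqF // div1r lnV ?posrE // mulrN opprK. Qed.

Section TailBounds.
Variables (R : realType) (T : finType) (W : {set T}) (G : graph T).
Hypotheses (WG : rooted W G) (eW_gt0 : (0 < ne_root W G)%N).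
Variable t : R.
Hypothesis t_gt1 : 1 < t.

Let p1 : R := root_threshold t (ne_root W G).
Let p2 : R := root_threshold t (ne G).
Let Kb : R := Num.max 1 (blowup_const W G t).

Let p1_gt0 : 0 < p1. Proof. exact: root_threshold_gt0. Qed.
Let p1_lt1 : p1 < 1. Proof. exact: root_threshold_lt1. Qed.
Let p2_lt1 : p2 < 1. Proof. exact: (root_threshold_lt1 t_gt1 (ne_gt0 eW_gt0)). Qed.
Let Kb1 : 1 <= Kb. Proof. by rewrite le_max lexx. Qed.
Let Kb0 : 0 < Kb. Proof. exact: lt_le_trans Kb1. Qed.
Let vR0 : (0 : R) < (2 * nv G)%:R.
Proof. by rewrite ltr0n muln_gt0 /= (leq_ltn_trans _ (card_roots_lt WG eW_gt0)). Qed.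

Lemma root_threshold_le : p1 <= p2.
Proof.
apply: ler_powR; first exact: ltW.
rewrite lerN2 lef_pV2 ?posrE ?ltr0n ?(ne_gt0 eW_gt0) // ler_nat.
by rewrite (ne_rootD W G) leq_addr.
Qed.

Lemma tail_eq0 n (p : R) : (nv G <= n)%N -> p2 < p -> upper_tail W G n p t = 0.
Proof.
move=> leVn lt; rewrite upper_tailE big_pred0 // => S; apply/negbTE.
have p0 : 0 < p := lt_trans (root_threshold_gt0 t_gt1 _) lt.
have N0 : (0 : R) < #|copies W G n|%:R by rewrite ltr0n copies_gt0.
rewrite -ltNge; apply: (@le_lt_trans _ _ #|copies W G n|%:R); first by rewrite ler_nat ncontained_le.
rewrite mulrCA ltr_pMr // ltNge -le_root_threshold ?(ltW p0) ?(ne_gt0 eW_gt0) //.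
by rewrite -ltNge.
Qed.

(** A subgraph H that attains m has Psi_H <= 1 here, so a blow-up of bounded size
suffices. For bounded n, when the blow-up does not fit, the complete graph is
planted. *)
Lemma tail_lower_sparse : exists2 C : R, 0 < C & forall n (p : R),
  (nv G <= n)%N -> 0 < p <= n%:R `^ (- (m_param R W G)^-1) -> p <= p2 ->
  p `^ C <= upper_tail W G n p t.
Proof.
pose CA := (ne G)%:R * (2 + Kb); pose CB := ((2 * nv G)%:R * Kb) ^+ 2.
have CA0 : 0 < CA by rewrite mulr_gt0 ?ltr0n ?(ne_gt0 eW_gt0) // addr_gt0.
have CB0 : 0 < CB by rewrite exprn_gt0 // mulr_gt0.
exists (CA + CB); first exact: addr_gt0.
move=> n p leVn /andP[p0 pthr] pp2.
have pl1 : p < 1 := le_lt_trans pp2 p2_lt1.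
have n0 := ambient_gt0 WG eW_gt0 leVn.
have pI : 0 < p <= 1 by rewrite p0 ltW.
have [Ka|aK] := leP Kb (block_size W G n)%:R.
  have [H [sH eH mE]] := m_param_attained R eW_gt0.
  have al1 := frac_indep_del_ge1 R WG sH eH.
  have Psi1 : Psi W H n p <= 1.
    apply: (Psi_root_threshold WG eW_gt0 n0 p0 sH eH) => //.
    by rewrite mE divfK // pnatr_eq0 -lt0n (nv_del_gt0 WG sH eH).
  apply: (@le_trans _ _ (p `^ CA)); first by apply: ger_powR; rewrite // lerDl ltW.
  apply: (blowup_lower WG eW_gt0 t_gt1 leVn _ sH eH); rewrite ?p0 ?Kb1 //.
  apply: (@le_trans _ _ Kb); last exact: le1r_powR.
  rewrite -[leRHS]mulr1; apply: (@le_trans _ _ (Kb * Psi W H n p)).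
    by rewrite ler_wpM2r ?(ltW (Psi_gt0 _ _ _ _)) // le_max lexx orbT.
  by rewrite ler_wpM2l // ltW.
have tp2 : t * p ^+ ne G <= 1 by rewrite -le_root_threshold ?(ne_gt0 eW_gt0) ?(ltW p0).
apply: le_trans (full_lower W n _ tp2); last by rewrite !ltW.
rewrite -powR_mulrn ?(ltW p0) //; apply: ger_powR => //.
apply: (@le_trans _ _ CB); last by rewrite lerDr ltW.
apply: (@le_trans _ _ ((n ^ 2)%N%:R)); first by rewrite ler_nat bin2_le.
rewrite natrX lerXn2r ?nnegrE ?mulr_ge0 ?(ltW Kb0) //.
apply: (@le_trans _ _ ((2 * nv G * block_size W G n)%N%:R)).
  by rewrite ler_nat n_le_block_size.
by rewrite natrM ler_wpM2l ?(ltW vR0) // ltW.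
Qed.

(** The blow-up with L = Kb M fits unless M, and hence n p, is at least a constant
times n. In that case p is bounded below, M is of order n, and dense_lower
applies with x = 0. *)
Lemma tail_lower_M : exists2 C : R, 0 < C & forall n (p : R),
  (nv G <= n)%N -> 0 < p -> n%:R `^ (- (m_param R W G)^-1) <= p <= p1 ->
  p `^ (C * M_param W G n p) <= upper_tail W G n p t.
Proof.
pose eps := ((2 * nv G)%:R * Kb)^-1.
have eps_gt0 : 0 < eps by rewrite invr_gt0 mulr_gt0.
have eps_lt1 : eps < 1.
  rewrite invf_lt1 ?mulr_gt0 //; apply: (@lt_le_trans _ _ (2 * 1)).
    by rewrite mulr1 ltr1n.
  apply: ler_pM => //; rewrite ler_nat leq_pmulr //.
  exact: leq_ltn_trans (card_roots_lt WG eW_gt0).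
have eps01 : 0 < eps < 1 by rewrite eps_gt0.
have [C C0 dense] := dense_lower WG eW_gt0 t_gt1 eps01.
pose l := - ln p1; have l0 : 0 < l by rewrite oppr_gt0 ln_lt0 // p1_gt0.
have epsX0 : 0 < eps ^+ ne G by rewrite exprn_gt0.
pose CA := (ne G)%:R * (2 + Kb); pose CB := C / (l * eps ^+ ne G).
have CA0 : 0 < CA by rewrite mulr_gt0 ?ltr0n ?(ne_gt0 eW_gt0) // addr_gt0.
have CB0 : 0 < CB by rewrite divr_gt0 // mulr_gt0.
exists (CA + CB); first exact: addr_gt0.
move=> n p leVn p0 /andP[pthr pp1].
have pl1 : p < 1 := le_lt_trans pp1 p1_lt1.
have n0 := ambient_gt0 WG eW_gt0 leVn; have nR0 : (0 : R) < n%:R by rewrite ltr0n.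
have pI : 0 < p <= 1 by rewrite p0 ltW.
have M1 := M_param_ge1 WG eW_gt0 n0 p0 pthr.
have Mge := M_param_ge WG eW_gt0 n0 p0 (ltW pl1).
have Mle := M_param_le WG eW_gt0 n0 p0.
have [H [sH eH]] := M_param_attained eW_gt0 n p.
set M := M_param W G n p in M1 Mge Mle * => ME.
have M0 : 0 < M := lt_le_trans ltr01 M1.
have al1 := frac_indep_del_ge1 R WG sH eH.
set al := frac_indep R (del H W) in ME al1.
have al0 : 0 < al := lt_le_trans ltr01 al1.
have [Ka|aK] := leP (Kb * M) (block_size W G n)%:R.
  apply: (@le_trans _ _ (p `^ ((ne G)%:R * (2 + Kb * M)))).
    apply: ger_powR => //; apply: (@le_trans _ _ (CA * M)).
      rewrite /CA -mulrA ler_wpM2l // mulrDl lerD2r.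
      by rewrite ler_peMr.
    by rewrite ler_wpM2r ?(ltW M0) // lerDl ltW.
  apply: (blowup_lower WG eW_gt0 t_gt1 leVn _ sH eH); rewrite ?p0 //.
    by rewrite Ka andbT -[leLHS]mulr1 ler_pM.
  rewrite -/al powRM ?(ltW Kb0) ?(ltW M0) //.
  have -> : M `^ al = Psi W H n p.
    by rewrite ME -powRrM mulVf ?gt_eqF // powRr1 // ltW // Psi_gt0.
  apply: ler_wpM2r; first by rewrite ltW // Psi_gt0.
  apply: (@le_trans _ _ Kb); first by rewrite le_max lexx orbT.
  exact: le1r_powR.
have ep : eps <= p.
  have le1 : n%:R <= (2 * nv G)%:R * (Kb * (n%:R * p)).
    apply: (@le_trans _ _ ((2 * nv G * block_size W G n)%N%:R)).
      by rewrite ler_nat n_le_block_size.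
    rewrite natrM ler_wpM2l ?(ltW vR0) //; apply: le_trans (ltW aK) _.
    by rewrite ler_wpM2l ?(ltW Kb0).
  rewrite /eps -[leLHS]mulr1 mulrC ler_pdivrMr ?mulr_gt0 //.
  rewrite -(ler_pM2l nR0) mulr1; apply: le_trans le1 _.
  by rewrite le_eqVlt; apply/orP; left; apply/eqP; move: (Kb) (_%:R) => a b; ring.
have epp2 : eps <= p <= p2 by rewrite ep (le_trans pp1) // root_threshold_le.
have px : p - root_threshold t (ne_root W G) <= 0 by rewrite subr_le0.
have := dense n p 0 leVn epp2 (lexx 0) px.
rewrite expr0n mul0r addr0; apply: le_trans.
rewrite /powR (gt_eqF p0) ler_expR lerNr -mulrN.
have lp : l <= - ln p by rewrite lerN2 ler_ln ?posrE.
apply: (@le_trans _ _ (CB * M * l)).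
  rewrite (_ : CB * M * l = C * (M / eps ^+ ne G)); last first.
    move: (lt0r_neq0 l0) (lt0r_neq0 epsX0); rewrite /CB.
    by move: (l) (eps ^+ ne G) => a b a0 b0; field; rewrite a0 b0.
  rewrite ler_wpM2l ?(ltW C0) // ler_pdivlMr //; apply: le_trans Mge.
  by rewrite ler_wpM2l // lerXn2r ?nnegrE ?(ltW eps_gt0) ?(ltW p0).
apply: ler_pM.
- by rewrite ltW // mulr_gt0.
- exact: ltW.
- by rewrite ler_wpM2r ?(ltW M0) // lerDr ltW.
- exact: lp.
Qed.

(** Both bounds hold for p >= p1, the first with M >= n p ^ e, and the larger of
the two exponents is at least their mean. *)
Lemma tail_upper_dense : exists2 c : R, 0 < c & forall n (p : R),
  (nv G <= n)%N -> p1 <= p <= 1 ->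
  upper_tail W G n p t <= expR (- (c * (n%:R + (p - p1) ^+ 2 * n%:R ^+ 2))).
Proof.
have [cM cM0 HM] := upper_tail_le_exp_M WG eW_gt0 t_gt1.
have [cS cS0 HS] := upper_tail_le_exp_sq WG eW_gt0 t_gt1.
have p1X : 0 < p1 ^+ ne G by rewrite exprn_gt0.
pose c := Num.min (cM * p1 ^+ ne G) cS.
have c0 : 0 < c by rewrite lt_min cS0 mulr_gt0.
exists (c / 2); first by rewrite divr_gt0.
move=> n p leVn /andP[p1p ple1].
have p0 : 0 < p := lt_le_trans p1_gt0 p1p.
have n0 := ambient_gt0 WG eW_gt0 leVn.
have [le1 _] : _ /\ _ := HM n p leVn (introT andP (conj p0 ple1)).
have le2 := HS n p leVn (introT andP (conj p1p ple1)).
set P := upper_tail W G n p t in le1 le2 *.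
set A := n%:R; set B := (p - p1) ^+ 2 * n%:R ^+ 2.
have PA : P <= expR (- (c * A)).
  apply: le_trans le1 _; rewrite ler_expR lerN2.
  apply: (@le_trans _ _ (cM * p1 ^+ ne G * n%:R)); first by rewrite ler_wpM2r // ge_min lexx.
  rewrite -mulrA ler_wpM2l ?(ltW cM0) //.
  apply: le_trans (M_param_ge WG eW_gt0 n0 p0 ple1); rewrite mulrC ler_wpM2l //.
  by rewrite lerXn2r ?nnegrE ?(ltW p0) ?(ltW p1_gt0).
have PB : P <= expR (- (c * B)).
  apply: le_trans le2 _; rewrite ler_expR lerN2 -/B.
  apply: ler_wpM2r; first by rewrite mulr_ge0 ?sqr_ge0.
  by rewrite ge_min lexx orbT.
have [AB|/ltW BA] := leP A B.
  apply: le_trans PB _; rewrite ler_expR lerN2 -mulrA ler_wpM2l ?(ltW c0) //.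
  by rewrite mulrC ler_pdivrMr // mulr_natr mulr2n lerD2r.
apply: le_trans PA _; rewrite ler_expR lerN2 -mulrA ler_wpM2l ?(ltW c0) //.
by rewrite mulrC ler_pdivrMr // mulr_natr mulr2n lerD2l.
Qed.

End TailBounds.

Theorem theorem3p1 (R : realType) (T : finType) (W : {set T}) (G : graph T)
    (WG : rooted W G) (eW_gt0 : (0 < ne_root W G)%N) (t : R) (t_gt1 : 1 < t) :
  exists c C : R, [/\ 0 < c, 0 < C &
    let p1 := t `^ (- (ne_root W G)%:R^-1) in
    let p2 := t `^ (- (ne G)%:R^-1) in
    forall (n : nat) (p : R), (nv G <= n)%N -> 0 < p <= 1 ->
    let thr := n%:R `^ (- (m_param R W G)^-1) in
    let M := M_param W G n p in
    let P := upper_tail W G n p t in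
    [/\ p <= thr ->
          [/\ p `^ C = expR (- (C * ln (1 / p))),
              p <= p2 -> p `^ C <= P
            & P <= expR (- c)],
        thr <= p <= p1 ->
          [/\ p `^ (C * M) = expR (- (C * M * ln (1 / p))),
              p `^ (C * M) <= P
            & P <= expR (- (c * M))],
        p1 <= p <= p2 ->
          expR (- (C * (n%:R + (p - p1) ^+ 2 * n%:R ^+ 2))) <= P /\
          P <= expR (- (c * (n%:R + (p - p1) ^+ 2 * n%:R ^+ 2)))
      & p2 < p <= 1 -> P = 0]].
Proof.
have [c1 c10 upM] := upper_tail_le_exp_M WG eW_gt0 t_gt1.
have [c2 c20 upD] := tail_upper_dense WG eW_gt0 t_gt1.
have [C1 C10 loS] := tail_lower_sparse WG eW_gt0 t_gt1.
have [C2 C20 loM] := tail_lower_M WG eW_gt0 t_gt1.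
have p1_01 : 0 < root_threshold t (ne_root W G) < 1.
  by rewrite root_threshold_gt0 // root_threshold_lt1.
have [C3 C30 loD] := dense_lower WG eW_gt0 t_gt1 p1_01.
exists (Num.min c1 c2), (C1 + C2 + C3); split.
- by rewrite lt_min c10.
- by rewrite !addr_gt0.
move=> p1 p2 n p leVn pI thr M P; have /andP[p0 ple1] := pI.
have n0 := ambient_gt0 WG eW_gt0 leVn.
have M0 : 0 <= M by rewrite ltW // M_param_gt0.
have [upM1 upM2] := upM n p leVn pI.
have Z0 : 0 <= n%:R + (p - p1) ^+ 2 * n%:R ^+ 2 by rewrite addr_ge0 // mulr_ge0 ?sqr_ge0.
split.
- move=> pthr; split; first exact: powR_expR_ln.
    move=> pp2; apply: (@le_trans _ _ (p `^ C1)).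
      by apply: ger_powR => //; rewrite -addrA lerDl addr_ge0 // ltW.
    by apply: loS; rewrite ?p0.
  apply: le_trans upM2 _; by rewrite ler_expR lerN2 ge_min lexx.
- move=> pthr; split; first exact: powR_expR_ln.
    apply: (@le_trans _ _ (p `^ (C2 * M))); last exact: loM.
    apply: ger_powR => //; rewrite ler_wpM2r //.
    by rewrite addrAC lerDr addr_ge0 // ltW.
  apply: le_trans upM1 _; by rewrite ler_expR lerN2 ler_wpM2r // ge_min lexx.
- move=> /andP[p1p pp2]; split.
    apply: (@le_trans _ _ (expR (- (C3 * (n%:R + (p - p1) ^+ 2 * n%:R ^+ 2))))).
      by rewrite ler_expR lerN2 ler_wpM2r // lerDr addr_ge0 // ltW.
    by apply: loD; rewrite ?subr_ge0 // ?p1p.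
  apply: (@le_trans _ _ (expR (- (c2 * (n%:R + (p - p1) ^+ 2 * n%:R ^+ 2))))).
    by apply: upD; rewrite ?p1p.
  by rewrite ler_expR lerN2 ler_wpM2r // ge_min lexx orbT.
by move=> /andP[p2p _]; apply: tail_eq0.
Qed.
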